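(* Fix an integer $d\geq 3$ and a real number $\lambda<d$. Let $G$ be an $(n,d,\lambda)$-graph whose girth $g$ satisfies $g\geq 10\log_{d-1}\log n$. Then, with high probability (as $n\to\infty$), the maximal number of times that a non-backtracking random walk of length $n$ on $G$ visits a vertex is equal to $(1+o(1))\frac{\log n}{\log\log n}$. That is: for every infinite sequence of $(n,d,\lambda)$-graphs $G=G_n=(V_n,E_n)$ with $n\to\infty$ and girth at least $10\log_{d-1}\log n$, every choice of starting vertices $w_0\in V_n$, and every $\varepsilon>0$, if $(w_0,w_1,\dots,w_n)$ is a non-backtracking random walk of length $n$ on $G_n$ from $w_0$, then $$\Pr\left[(1-\varepsilon)\frac{\log n}{\log\log n}\leq \max_{v\in V_n}\big|\{t\in\{0,1,\dots,n\}: w_t=v\}\big|\leq(1+\varepsilon)\frac{\log n}{\log\log n}\right]\to 1 .$$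
   Context: Graphs are finite, undirected and simple; the girth of a graph is the length of its shortest cycle. Logarithms without a specified base are natural. For a $d$-regular graph on $n$ vertices with adjacency eigenvalues $d=\lambda_1\geq\lambda_2\geq\dots\geq\lambda_n$, an $(n,d,\lambda)$-graph (with $\lambda<d$) is a $d$-regular graph on $n$ vertices whose second largest eigenvalue in absolute value is $\lambda$, i.e. $\lambda=\max\{\lambda_2,|\lambda_n|\}$. A non-backtracking random walk of length $k$ on $G=(V,E)$ from a vertex $w_0$ is a uniformly chosen member of the set of sequences $(w_0,w_1,\dots,w_k)$ of vertices with $w_{t-1}w_t\in E$ for all $1\leq t\leq k$ and $w_{t-1}\neq w_{t+1}$ for all $1\leq t\leq k-1$. An event defined for an infinite series of graphs occurs with high probability (almost surely) if its probability tends to $1$ as the number of vertices tends to infinity. *)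

(* Defs.v *)
From mathcomp Require Import all_boot all_order all_algebra.
From mathcomp Require Import all_classical all_reals all_analysis.
Set Implicit Arguments.
Unset Strict Implicit.
Unset Printing Implicit Defensive.
Import Order.TTheory GRing.Theory Num.Theory.
Import numFieldNormedType.Exports.
Local Open Scope classical_set_scope.
Local Open Scope ring_scope.

Record sgraph := SGraph {
  vert :> finType;
  adj : rel vert;
  adj_sym : symmetric adj;
  adj_irrefl : irreflexive adj
}.

Definition regular (G : sgraph) (d : nat) : Prop :=
  forall v : G, #|[set u : G | adj v u]%SET| = d.

(* A cycle is the list of its vertices, each joined to the next one and the
   last to the first; a list of size 2 would traverse a single edge twice. *)
Definition graph_cycle (G : sgraph) (c : seq G) : bool :=
  (2 < size c)%N && ucycleb (@adj G) c.

(* The girth of an acyclic graph is +oo. *)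
Definition girth (R : realType) (G : sgraph) : \bar R :=
  ereal_inf [set ((size c)%:R)%:E | c in [set c : seq G | graph_cycle c]].

Definition adjmx (R : realType) (G : sgraph) : 'M[R]_#|G| :=
  \matrix_(i, j) (adj (enum_val i) (enum_val j))%:R.

(* s = [:: lambda_1; ...; lambda_n] lists the eigenvalues of A with
   multiplicity, in nonincreasing order. *)
Definition is_spectrum (R : realType) (n : nat) (A : 'M[R]_n) (s : seq R) :
    Prop :=
  sorted >=%R s /\ char_poly A = \prod_(x <- s) ('X - x%:P).

(* Lists are indexed from 0: s`_1 is lambda_2 and s`_n.-1 is lambda_n. *)
Definition ndl_graph (R : realType) (G : sgraph) (n d : nat) (lambda : R) :
    Prop :=
  [/\ #|G| = n, regular G d, lambda < d%:R &
      exists2 s : seq R, is_spectrum (adjmx R G) s &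
                         lambda = Num.max s`_1 `|s`_n.-1| ].

(* w_t is nth w0 w t; all the indices below are at most k, so that the default
   value w0 of nth is never used. *)
Definition nb_walk (G : sgraph) (w0 : G) (k : nat) (w : k.+1.-tuple G) : bool :=
  [&& nth w0 w 0 == w0,
      [forall t : 'I_k, adj (nth w0 w t) (nth w0 w t.+1)] &
      [forall t : 'I_k.-1, nth w0 w t != nth w0 w t.+2]].

Definition nb_walks (G : sgraph) (w0 : G) (k : nat) : {set k.+1.-tuple G} :=
  [set w : k.+1.-tuple G | nb_walk w0 w]%SET.

Definition uniform_pr (R : realType) (T : finType) (S : {set T})
    (E : pred T) : R :=
  #|[set x in S | E x]%SET|%:R / #|S|%:R.

Definition visits (G : sgraph) (k : nat) (w : k.+1.-tuple G) (v : G) : nat :=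
  #|[set t : 'I_k.+1 | tnth w t == v]%SET|.

Definition max_visits (G : sgraph) (k : nat) (w : k.+1.-tuple G) : nat :=
  \max_(v : G) visits w v.

Definition logb (R : realType) (b x : R) : R := ln x / ln b.

(* Main.v *)
Require Import Defs.
From mathcomp Require Import all_boot all_order all_algebra complex.
From mathcomp Require Import all_classical all_reals all_analysis.
From mathcomp Require Import ring lra zify.
Set Implicit Arguments.
Unset Strict Implicit.
Unset Printing Implicit Defensive.
Import Order.TTheory GRing.Theory Num.Theory.
Import numFieldNormedType.Exports.
Local Open Scope classical_set_scope.
Local Open Scope ring_scope.

(** Write b for d - 1, l for ln n and L for l / ln l.  A non-backtracking walk is
    a Markov chain on directed edges, so everything rests on the numbers
    [hit k u v y]: the probability that a walk that has just crossed the edge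
    (u, v) is at y after k more steps.  Two facts about them carry the proof.

    Mixing ([hit_mixing]).  The matrices that count non-backtracking walks
    satisfy a three-term recurrence, hence are polynomials in the adjacency
    matrix.  On eigenvalues of absolute value at most lambda < d these
    polynomials grow like beta ^ k for some beta < b, because a quadratic energy
    of the recurrence decreases ([nbenergy_le]); on the eigenvalue d they grow
    like b ^ k.  So [hit k u v y] differs from 1 / n by at most
    K n (beta / b) ^ k, and beyond some tau = O(l) steps the position is uniform
    up to a relative error 1 / n.

    Girth ([hit_short_le], [hit_long_le], [hit_return0]).  Below half the girth
    two vertices are joined by at most one non-backtracking walk of given length.
    Taking 2h below the girth and b ^ h at least of order l ^ 4, a walk cannot
    return to its current vertex within 2h steps, and each later step hits a
    given vertex with probability at most b ^ - h.  Returns within tau steps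
    thus have total probability at most tau b ^ - h, which is below 1 / l.

    Upper bound ([max_visits_tail]).  After a visit to y, the next visit comes
    either soon, with negligible probability, or at a time when each step has
    probability at most 2 / n.  As for uniform independent positions, the
    probability of m returns within n steps is then at most 8 ^ m / m!, by
    induction on m.  For m = (1 + eps) L this is n ^ - (1 + eps / 4) at most, which
    survives the union bound over the n vertices.

    Lower bound ([min_visits_tail]).  Cut the walk into m = (1 - eps) L chunks of
    equal length, ignore the first tau steps of each, and let Y be the sum over
    y of the product over the chunks of the numbers of visits to y.  A positive
    Y exhibits a vertex with m visits.  Mixing makes the chunks nearly
    independent, so the mean of Y is about n (r / n) ^ m, where r is the number of
    counted steps of a chunk.  The second moment is a sum over pairs (x, y) of
    m-th powers; it exceeds the squared mean only through pairs close to each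
    other, and these contribute a factor at most (C m) ^ m = n ^ (1 - eps + o(1)) on
    few pairs.  Chebyshev's inequality concludes. *)

(** * Non-backtracking walks and expectations along them *)

Section Walks.
Variable G : sgraph.
Implicit Types (u v x y : G) (s : seq G).

(** The edge (u, v) is the last one crossed before [s]; carrying it makes the
    non-backtracking condition local. *)
Fixpoint nbpath u v s : bool :=
  if s is x :: s' then [&& adj v x, x != u & nbpath v x s'] else true.

Definition penult u v s : G := last u (belast v s).

Lemma nbpath_adj u v s :
  adj u v -> nbpath u v s -> adj (penult u v s) (last v s).
Proof.
elim: s u v => [//|x s IH] u v uv /= /and3P[vx _ xs].
exact: IH.
Qed.

Lemma nbpath_cat u v s1 s2 :
  nbpath u v (s1 ++ s2) =
  nbpath u v s1 && nbpath (penult u v s1) (last v s1) s2.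
Proof. by elim: s1 u v => //= x s1 IH u v; rewrite IH -!andbA. Qed.

End Walks.

Section Expectation.
Variables (R : realType) (G : sgraph) (b : nat).
Implicit Types (u v x y : G) (s : seq G) (F : seq G -> R).

(** The mean of [F] over the [k] next vertices of a walk that has just crossed
    (u, v).  Dividing by the constant [b] at each step, rather than by the number
    of continuations, is correct in a graph of degree [b.+1] only. *)
Fixpoint nbexp (k : nat) u v F : R :=
  if k is k'.+1 then
    b%:R^-1 * \sum_(x | adj v x && (x != u)) nbexp k' v x (fun s => F (x :: s))
  else F [::].

Lemma nbexp0 u v F : nbexp 0 u v F = F [::]. Proof. by []. Qed.

Lemma le_nbexp k u v F F' :
  (forall s, size s = k -> nbpath u v s -> F s <= F' s) ->
  nbexp k u v F <= nbexp k u v F'.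
Proof.
elim: k u v F F' => [|k IH] u v F F' FF' /=; first exact: FF'.
apply: ler_wpM2l; first by rewrite invr_ge0.
apply: ler_sum => x /andP[vx xu]; apply: IH => s sk xs.
by apply: FF'; rewrite /= ?sk ?vx ?xu.
Qed.

Lemma eq_nbexp k u v F F' :
  (forall s, size s = k -> nbpath u v s -> F s = F' s) ->
  nbexp k u v F = nbexp k u v F'.
Proof.
by move=> FF'; apply/eqP; rewrite eq_le !le_nbexp // => s sk vs;
  rewrite FF'.
Qed.

Lemma nbexp_sum k u v (I : Type) (r : seq I) (P : pred I) (F : I -> seq G -> R) :
  nbexp k u v (fun s => \sum_(i <- r | P i) F i s) =
  \sum_(i <- r | P i) nbexp k u v (F i).
Proof.
elim: k u v F => [//|k IH] u v F /=.
under eq_bigr do rewrite IH.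
by rewrite exchange_big /= mulr_sumr.
Qed.

Lemma nbexpD k u v F F' :
  nbexp k u v (fun s => F s + F' s) = nbexp k u v F + nbexp k u v F'.
Proof.
elim: k u v F F' => [//|k IH] u v F F' /=.
by under eq_bigr do rewrite IH; rewrite big_split mulrDr.
Qed.

Lemma nbexpZ k u v c F :
  nbexp k u v (fun s => c * F s) = c * nbexp k u v F.
Proof.
elim: k u v F => [//|k IH] u v F /=.
by under eq_bigr do rewrite IH; rewrite -mulr_sumr mulrCA.
Qed.

Lemma nbexpZr k u v c F :
  nbexp k u v (fun s => F s * c) = nbexp k u v F * c.
Proof. by rewrite mulrC -nbexpZ; apply: eq_nbexp => s _ _; rewrite mulrC. Qed.

Lemma nbexp_ge0 k u v F :
  (forall s, size s = k -> nbpath u v s -> 0 <= F s) -> 0 <= nbexp k u v F.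
Proof.
move=> F0; apply: le_trans (le_nbexp F0).
by rewrite (_ : (fun=> 0) = fun s : seq G => 0 * 0 :> R) ?nbexpZ ?mul0r //;
  apply/funext => s; rewrite mul0r.
Qed.

(** The Markov property on directed edges. *)
Lemma nbexp_tower a c u v F :
  nbexp (a + c) u v F =
  nbexp a u v (fun s => nbexp c (penult u v s) (last v s) (fun s' => F (s ++ s'))).
Proof.
elim: a u v F => [//|a IH] u v F /=; congr (_ * _).
by apply: eq_bigr => x _; rewrite IH.
Qed.

Section Regular.
Hypotheses (b_gt0 : (0 < b)%N) (regG : regular G b.+1).

Lemma card_nbext u v : adj u v -> #|[pred x | adj v x && (x != u)]| = b.
Proof.
move=> uv; have vu : adj v u by rewrite adj_sym.
have := regG v; rewrite (cardsD1 u) inE vu add1n => -[<-].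
by apply: eq_card => x; rewrite !inE andbC.
Qed.

Lemma nbexp_cst k u v c : adj u v -> nbexp k u v (fun=> c) = c.
Proof.
elim: k u v => [//|k IH] u v uv /=.
under eq_bigr => x /andP[vx _] do rewrite (IH _ _ vx).
by rewrite sumr_const (card_nbext uv) -[c *+ b]mulr_natl mulKf // pnatr_eq0 -lt0n.
Qed.

Lemma nbexp_le k u v F c : adj u v ->
  (forall s, size s = k -> nbpath u v s -> F s <= c) -> nbexp k u v F <= c.
Proof. by move=> uv Fc; rewrite -[leRHS](nbexp_cst k c uv); apply: le_nbexp. Qed.

End Regular.

Lemma sum_tupleS (T : finType) k (F : seq T -> R) :
  \sum_(t : k.+1.-tuple T) F t = \sum_x \sum_(t : k.-tuple T) F (x :: t).
Proof.
rewrite (reindex (fun p : T * k.-tuple T => [tuple of p.1 :: p.2])) /=.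
  by rewrite pair_bigA.
exists (fun t => (thead t, [tuple of behead t])) => [[x t] _|t _] /=.
  by congr pair; apply: val_inj.
by rewrite -tuple_eta.
Qed.

Lemma sum_nbpath k u v F : (0 < b)%N ->
  \sum_(t : k.-tuple G) (nbpath u v t)%:R * F t = b%:R ^+ k * nbexp k u v F.
Proof.
move=> b0; elim: k u v F => [|k IH] u v F.
  rewrite (eq_bigr (fun=> F [::])) => [|t _]; last by rewrite (tuple0 t) /= mul1r.
  by rewrite sumr_const card_tuple expn0 mul1r.
rewrite (sum_tupleS _ (fun t => (nbpath u v t)%:R * F t)) /= exprSr -mulrA.
rewrite mulVKf ?pnatr_eq0 -?lt0n // mulr_sumr.
rewrite [RHS]big_mkcond /=; apply: eq_bigr => x _.
by rewrite -IH; case: (adj v x) (x != u) => [] [] //=;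
  rewrite big1 // => t _; rewrite mul0r.
Qed.

Lemma nb_walk_cons (w0 : G) k (w : k.+2.-tuple G) :
  nb_walk w0 w =
  if val w is a :: x :: s then [&& a == w0, adj w0 x & nbpath w0 x s] else false.
Proof.
case: w => -[|a [|x s]] //= ws.
rewrite /nb_walk /=.
have sk : size s = k by move: ws => /= /eqP[].
case: eqP => //= ->; clear a ws.
have E (P : nat -> bool) m : [forall t : 'I_m, P t] = all P (iota 0 m).
  apply/forallP/allP => [H i|H i]; last by apply: H; rewrite mem_iota /=.
  by rewrite mem_iota /= add0n => im; exact: (H (Ordinal im)).
rewrite (E (fun t => adj (nth w0 [:: w0, x & s] t) (nth w0 (x :: s) t))).
rewrite (E (fun t => nth w0 [:: w0, x & s] t != nth w0 s t)).
rewrite -{}sk /=; clear.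
have S (P : pred nat) m :
    all P (iota 0 m.+1) = P 0%N && all (fun i => P i.+1) (iota 0 m).
  by rewrite /= -[1%N]/(1 + 0)%N iotaDl all_map.
suff H u : all (fun t => adj (nth w0 [:: u, x & s] t) (nth w0 (x :: s) t))
        (iota 0 (size s).+1) &&
      all (fun t => nth w0 [:: u, x & s] t != nth w0 s t) (iota 0 (size s)) =
    adj u x && nbpath u x s by exact: (H w0).
elim: s u x => [|y s IH] u x; first by rewrite /= !andbT.
rewrite [size (y :: s)]/= S [X in _ && X]S -andbA.
have -> : nbpath u x (y :: s) = (y != u) && (adj x y && nbpath x y s).
  by rewrite /= andbCA.
rewrite -IH [y == u]eq_sym.
by congr (_ && _); rewrite andbCA.
Qed.

(** After its first step each walk has exactly [b] continuations at every step,
    so all walks have the same weight in [nbexp]: drawing a whole walk uniformly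
    is the same as drawing its steps one at a time. *)
Lemma uniform_pr_nbexp (w0 : G) k (P : pred (seq G)) :
  (0 < b)%N -> regular G b.+1 ->
  uniform_pr R (nb_walks w0 k.+1) (fun w => P w) =
  b.+1%:R^-1 * \sum_(x | adj w0 x) nbexp k w0 x (fun s => (P [:: w0, x & s])%:R).
Proof.
move=> b0 rG; rewrite /uniform_pr.
have Q (Q : pred (seq G)) : #|[set x in nb_walks w0 k.+1 | Q x]%SET|%:R =
    b%:R ^+ k * \sum_(x | adj w0 x) nbexp k w0 x (fun s => (Q [:: w0, x & s])%:R).
  rewrite mulr_sumr -sum1_card natr_sum big_mkcond /=.
  rewrite (eq_bigr (fun w : k.+2.-tuple G =>
     (if val w is a :: x :: s then [&& a == w0, adj w0 x & nbpath w0 x s] else false)%:R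
     * (Q w)%:R)); last first.
    move=> w _; rewrite !inE nb_walk_cons; case: (Q w); rewrite ?andbT ?andbF ?mulr0 // mulr1.
    by case: (val w) => [|a [|x s]] //; case: ifP.
  rewrite (sum_tupleS _ (fun t =>
     (if t is a :: x :: s then [&& a == w0, adj w0 x & nbpath w0 x s] else false)%:R
     * (Q t)%:R)).
  rewrite (bigD1 w0) //= [X in _ + X]big1 ?addr0; last first.
    move=> a /negPf aw; rewrite big1 // => -[[|x s] /= _] _; rewrite ?mul0r //.
    by rewrite aw mul0r.
  rewrite (sum_tupleS _ (fun t =>
     (if t is x :: s then [&& w0 == w0, adj w0 x & nbpath w0 x s] else false)%:R
     * (Q (w0 :: t))%:R)).
  rewrite [RHS]big_mkcond /=; apply: eq_bigr => x _; rewrite eqxx /=.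
  case: ifP => _ /=; last by rewrite big1 // => t _; rewrite mul0r.
  by rewrite -sum_nbpath.
have -> : #|nb_walks w0 k.+1| = #|[set x in nb_walks w0 k.+1 | predT (val x)]%SET|.
  by apply: eq_card => w; rewrite !inE andbT.
rewrite (Q P) (Q predT) /=.
have -> : \sum_(x | adj w0 x) nbexp k w0 x (fun=> true%:R) = b.+1%:R.
  under eq_bigr => x w0x do rewrite (nbexp_cst _ _ _ _ w0x) //.
  by rewrite sumr_const -(rG w0) cardsE.
rewrite invfM mulrACA mulfV ?mul1r 1?mulrC //.
by rewrite expf_neq0 // pnatr_eq0 -lt0n.
Qed.

End Expectation.

Section UniformPr.
Variables (R : realType) (T : finType) (S : {set T}).

Lemma uniform_pr_le (P Q : pred T) :
  (forall x, P x -> Q x) -> uniform_pr R S P <= uniform_pr R S Q.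
Proof.
move=> PQ; rewrite ler_wpM2r ?invr_ge0 // ler_nat.
by apply/subset_leq_card/fintype.subsetP => x; rewrite !inE => /andP[-> /PQ].
Qed.

Lemma uniform_pr_or (P Q : pred T) :
  uniform_pr R S (fun x => P x || Q x) <= uniform_pr R S P + uniform_pr R S Q.
Proof.
rewrite -mulrDl ler_wpM2r ?invr_ge0 // -natrD ler_nat.
apply: leq_trans (leq_card_setU _ _).
by apply/subset_leq_card/fintype.subsetP => x; rewrite !inE andb_orr.
Qed.

Lemma uniform_pr_le1 (P : pred T) : uniform_pr R S P <= 1.
Proof.
rewrite /uniform_pr; have [->|S0] := posnP #|S|; first by rewrite invr0 mulr0.
rewrite ler_pdivrMr ?ltr0n // mul1r ler_nat.
by apply/subset_leq_card/fintype.subsetP => x; rewrite !inE => /andP[].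
Qed.

End UniformPr.

Lemma uniform_pr_walks1 (R : realType) (G : sgraph) b k (w0 : G) :
  (0 < b)%N -> regular G b.+1 ->
  uniform_pr R (nb_walks w0 k.+1) predT = 1.
Proof.
move=> b0 rG; have /= -> := uniform_pr_nbexp R w0 k predT b0 rG.
under eq_bigr => x w0x do rewrite (nbexp_cst b0 rG _ _ w0x).
by rewrite sumr_const -cardsE rG mulVf.
Qed.

(** * Spectrum and mixing *)

Lemma char_poly_similar (F : fieldType) n (P A : 'M[F]_n) :
  P \in unitmx -> char_poly (invmx P *m A *m P) = char_poly A.
Proof.
move=> Pu; rewrite /char_poly /char_poly_mx.
have cPu : map_mx polyC P \in unitmx by rewrite map_unitmx.
have -> : 'X%:M - map_mx polyC (invmx P *m A *m P) =
    invmx (map_mx polyC P) *m ('X%:M - map_mx polyC A) *m map_mx polyC P.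
  rewrite !map_mxM map_invmx mulmxBr mulmxBl; congr (_ - _).
  by rewrite scalar_mxC -mulmxA mulVmx // mulmx1.
rewrite !det_mulmx mulrAC -det_mulmx mulVmx // det1 mul1r //.
Qed.

(** A real symmetric matrix is normal over the complex numbers, hence diagonal
    in some basis; the diagonal is the given list of roots because both give the
    linear factors of the characteristic polynomial.  Only traces are taken
    afterwards, so a complex basis does no harm. *)
Lemma symmetric_diag_char_poly (R : rcfType) n (A : 'M[R]_n) (s : seq R) :
  A^T = A -> char_poly A = \prod_(x <- s) ('X - x%:P) ->
  exists P, exists D : 'rV[complex R]_n,
    [/\ P \in unitmx,
        map_mx (real_complex R) A = invmx P *m diag_mx D *m P &
        perm_eq [seq D 0 i | i : 'I_n] [seq real_complex R x | x <- s]].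
Proof.
move=> As charA; set A' := map_mx _ A.
have A'n : A' \is normalmx.
  apply: symmetric_normalmx.
    by apply/is_hermitianmxP; rewrite expr0 scale1r map_mx_id // /A' map_trmx As.
  by apply/mxOverP => i j; rewrite mxE; apply/complex_realP; exists (A i j).
have /orthomx_spectralP := A'n.
set P := spectralmx A'; set D := spectral_diag A' => A'E.
exists P, D; split=> //; first exact: spectral_unit.
apply: prod_XsubC_eq; rewrite big_image [RHS]big_map /=.
transitivity (char_poly A').
  rewrite A'E char_poly_similar ?spectral_unit // char_poly_trig ?diag_mx_is_trig //.
  by apply: eq_bigr => i _; rewrite mxE eqxx mulr1n.
rewrite -map_char_poly charA rmorph_prod; apply: eq_bigr => x _ /=.
by rewrite rmorphB /= map_polyX map_polyC.
Qed.

(** The polynomial whose value at the adjacency matrix counts the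
    non-backtracking walks of length [k.+1].  The recurrence starts at length 1:
    from length 1 to length 2 the term removed is [b.+1], afterwards it is [b]
    times the previous polynomial. *)
Fixpoint nbpoly (S : comNzRingType) (b : nat) k (x : S) : S :=
  match k with
  | 0 => x
  | k1.+1 => match k1 with
             | 0 => x ^+ 2 - b.+1%:R
             | k2.+1 => x * nbpoly b k1 x - b%:R * nbpoly b k2 x
             end
  end.

Lemma rmorph_nbpoly (S T : comNzRingType) (f : {rmorphism S -> T}) b k x :
  f (nbpoly b k x) = nbpoly b k (f x).
Proof.
suff: f (nbpoly b k x) = nbpoly b k (f x) /\
      f (nbpoly b k.+1 x) = nbpoly b k.+1 (f x) by case.
elim: k => [|k [IH0 IH1]]; first by rewrite /= rmorphB rmorphXn rmorph_nat.
by split=> //; rewrite [LHS]/= rmorphB !rmorphM rmorph_nat IH0 IH1.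
Qed.

Lemma nbpoly_degree (S : comNzRingType) b k :
  nbpoly b k (b.+1%:R : S) = b.+1%:R * b%:R ^+ k.
Proof.
suff: nbpoly b k (b.+1%:R : S) = b.+1%:R * b%:R ^+ k /\
      nbpoly b k.+1 (b.+1%:R : S) = b.+1%:R * b%:R ^+ k.+1 by case.
elim: k => [|k [IH0 IH1]]; first by split=> /=; rewrite -?[b.+1]addn1 natrD; ring.
split=> //; rewrite [LHS]/= -/(nbpoly b k.+1 _) IH0 IH1 -[b.+1]addn1 natrD !exprS.
by ring.
Qed.

(** [M k] is the value of [nbpoly b k] at the matrix [A].  The recurrence defines
    it for every size, including the empty matrix, and is the form in which the
    numbers of walks arise. *)
Section NBMatrix.
Variables (F : fieldType) (n b : nat) (A : 'M[F]_n) (M : nat -> 'M[F]_n).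
Hypotheses (M0 : M 0 = A) (M1 : M 1 = A *m A - b.+1%:R%:M)
  (MS : forall k, M k.+2 = A *m M k.+1 - b%:R *: M k).

(** Transposition turns A M into M A, so symmetry is proved together with
    commutation with [A]. *)
Lemma trmx_nbmx k : A^T = A -> (M k)^T = M k.
Proof.
move=> At; suff: [/\ (M k)^T = M k, (M k.+1)^T = M k.+1,
  A *m M k = M k *m A & A *m M k.+1 = M k.+1 *m A] by case.
elim: k => [|k [IH0 IH1 C0 C1]].
  rewrite M0 M1 linearB /= trmx_mul tr_scalar_mx At; split=> //.
  by rewrite mulmxBr mulmxBl mulmxA scalar_mxC.
split=> //; rewrite MS.
  by rewrite linearB linearZ /= trmx_mul IH0 IH1 At C1.
by rewrite mulmxBr mulmxBl -scalemxAr -scalemxAl C0 -mulmxA C1.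
Qed.

Lemma nbmx_conj k (P : 'M[F]_n) (D : 'rV[F]_n) : P \in unitmx ->
  A = invmx P *m diag_mx D *m P ->
  M k = invmx P *m diag_mx (\row_j nbpoly b k (D 0 j)) *m P.
Proof.
move=> Pu AE; pose Dk k := \row_j nbpoly b k (D 0 j).
have conjM (X Y : 'M[F]_n) :
    (invmx P *m X *m P) *m (invmx P *m Y *m P) = invmx P *m (X *m Y) *m P.
  by rewrite !mulmxA mulmxK.
suff [] : M k = invmx P *m diag_mx (Dk k) *m P /\
  M k.+1 = invmx P *m diag_mx (Dk k.+1) *m P by [].
elim: k => [|k [IH0 IH1]].
  split.
    by rewrite M0 AE; congr (_ *m diag_mx _ *m _); apply/rowP => j; rewrite !mxE.
  rewrite M1 AE conjM mulmx_diag -[b.+1%:R%:M]mulmx1 -(mulVmx Pu).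
  rewrite [_%:M *m _]mulmxA -scalar_mxC -mulmxBl -mulmxBr; congr (_ *m _ *m _).
  by apply/matrixP => i j; rewrite !mxE; case: eqP => [->|_];
    rewrite ?mulr1n ?mulr0n ?subr0 //= expr2.
split=> //; rewrite MS IH0 IH1 AE conjM mulmx_diag.
rewrite scalemxAl scalemxAr -mulmxBl -mulmxBr; congr (_ *m _ *m _).
by apply/matrixP => i j; rewrite !mxE; case: eqP => [->|_];
  rewrite ?mulr1n ?mulr0n ?mulr0 ?subr0.
Qed.

Lemma nbmx_row_sum k i :
  (forall i, \sum_j A i j = b.+1%:R) -> \sum_j M k i j = b.+1%:R * b%:R ^+ k.
Proof.
move=> A1; rewrite -nbpoly_degree; pose o : 'cV[F]_n := const_mx 1.
have oE (B : 'M[F]_n) l : \sum_j B l j = (B *m o) l 0.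
  by rewrite mxE; apply: eq_bigr => j _; rewrite mxE mulr1.
have Ao : A *m o = b.+1%:R *: o.
  by apply/matrixP => l j; rewrite ord1 -oE A1 !mxE mulr1.
suff [E _] : M k *m o = nbpoly b k b.+1%:R *: o /\
    M k.+1 *m o = nbpoly b k.+1 b.+1%:R *: o by rewrite oE E !mxE mulr1.
elim: k => [|k [IH0 IH1]].
  rewrite M0 M1 mulmxBl -mulmxA !Ao -scalemxAr Ao scalerA -expr2 mul_scalar_mx.
  by rewrite -scalerBl.
split=> //; rewrite MS mulmxBl -mulmxA IH1 -scalemxAl IH0 -scalemxAr Ao !scalerA.
by rewrite -scalerBl [_ * b.+1%:R]mulrC.
Qed.

End NBMatrix.

Lemma mxtrace_nbmx_sqr (R : rcfType) n b (A : 'M[R]_n) (M : nat -> 'M[R]_n)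
    k (s : seq R) :
  M 0 = A -> M 1 = A *m A - b.+1%:R%:M ->
  (forall k, M k.+2 = A *m M k.+1 - b%:R *: M k) ->
  A^T = A -> char_poly A = \prod_(x <- s) ('X - x%:P) ->
  \tr (M k *m M k) = \sum_(x <- s) nbpoly b k x ^+ 2.
Proof.
move=> M0 M1 MS At charA.
have [P [D [Pu AE sD]]] := symmetric_diag_char_poly At charA.
pose f := real_complex R.
have ME : map_mx f (M k) = invmx P *m diag_mx (\row_j nbpoly b k (D 0 j)) *m P.
  apply: (@nbmx_conj _ n b (map_mx f A) (fun k => map_mx f (M k))) Pu AE.
  - by rewrite M0.
  - by rewrite M1 map_mxB map_mxM map_scalar_mx rmorph_nat.
  - by move=> l; rewrite MS map_mxB map_mxM map_mxZ rmorph_nat.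
apply: (fmorph_inj f); rewrite -trace_map_mx map_mxM ME !mulmxA mulmxK //.
rewrite mxtrace_mulC !mulmxA mulmxV // mul1mx mulmx_diag mxtrace_diag rmorph_sum.
transitivity (\sum_(z <- [seq f x | x <- s]) nbpoly b k z ^+ 2).
  rewrite -(perm_big _ sD) big_image /=.
  by apply: eq_bigr => i _; rewrite !mxE expr2.
by rewrite big_map; apply: eq_bigr => x _; rewrite rmorphXn rmorph_nbpoly.
Qed.

(** With a = x / beta, c = b / beta ^ 2 and v_k = nbpoly b k x / beta ^ k, the
    recurrence is v_(k+2) = a v_(k+1) - c v_k, and up to the factor
    beta ^ (2k + 4) this is the quadratic form
    (1 + c) (v_(k+1) ^ 2 + v_k ^ 2) - 2 a v_k v_(k+1).  It is definite as soon as
    |a| < 1 + c, whether or not the roots of the recurrence are real, and it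
    decreases when c <= 1. *)
Definition nbenergy (R : comNzRingType) b (beta x : R) k : R :=
  (beta ^+ 2 + b%:R) *
    (nbpoly b k.+1 x ^+ 2 + beta ^+ 2 * nbpoly b k x ^+ 2)
  - 2 * x * beta ^+ 2 * nbpoly b k x * nbpoly b k.+1 x.

Lemma nbenergy_le (R : realFieldType) b (beta x : R) k :
  b%:R <= beta ^+ 2 ->
  nbenergy b beta x k <= beta ^+ (2 * k) * nbenergy b beta x 0.
Proof.
move=> bb; elim: k => [|k IH]; first by rewrite mul1r.
rewrite mulnS exprD -mulrA; apply: le_trans (ler_wpM2l (sqr_ge0 _) IH).
rewrite /nbenergy -subr_ge0 [nbpoly b k.+2 x]/= -/(nbpoly b k.+1 x).
set y := nbpoly b k.+1 x; set z := nbpoly b k x.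
rewrite [leRHS](_ : _ =
  (beta ^+ 2 - b%:R) * (x * y - (beta ^+ 2 + b%:R) * z) ^+ 2); last by ring.
by rewrite mulr_ge0 ?sqr_ge0 // subr_ge0.
Qed.

(** The hypothesis [lambda * beta < beta ^+ 2 + b%:R] makes the energy definite
    uniformly in [x], so the decreasing energy bounds the polynomial. *)
Lemma nbpoly_bound (R : realFieldType) b (beta lambda : R) :
  0 < beta -> b%:R <= beta ^+ 2 -> lambda * beta < beta ^+ 2 + b%:R ->
  0 <= lambda ->
  exists2 C : R, 0 <= C & forall x, `|x| <= lambda -> forall k,
    nbpoly b k x ^+ 2 <= C * beta ^+ (2 * k).
Proof.
move=> beta0 bb lb l0; set B := beta ^+ 2.
set g := (B + b%:R - lambda * beta) * B.
have B0 : 0 < B by rewrite exprn_gt0.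
have g0 : 0 < g by rewrite mulr_gt0 // subr_gt0.
pose C := (B + b%:R) * ((lambda ^+ 2 + b.+1%:R) ^+ 2 + B * lambda ^+ 2)
  + 2 * lambda ^+ 2 * B * (lambda ^+ 2 + b.+1%:R).
have C0 : 0 <= C by rewrite /C !(ltW B0, sqr_ge0, addr_ge0, mulr_ge0, ler0n).
exists (C / g); first by rewrite divr_ge0 // ltW.
move=> x xl k; rewrite mulrAC ler_pdivlMr //.
have := nbenergy_le x k bb; rewrite /nbenergy [nbpoly b 0 x]/= [nbpoly b 1 x]/= -/B.
set y := nbpoly b k.+1 x; set z := nbpoly b k x; set E0 := (X in _ <= _ * X).
have E0C : E0 <= C.
  have x2 : x ^+ 2 <= lambda ^+ 2.
    by rewrite -real_normK ?num_real // lerXn2r ?nnegrE.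
  have xd : `|x ^+ 2 - b.+1%:R| <= lambda ^+ 2 + b.+1%:R.
    apply: (le_trans (ler_normB _ _)); rewrite normr_nat lerD2r.
    by rewrite ger0_norm ?sqr_ge0.
  rewrite /E0 /C; apply: lerD.
    apply: ler_wpM2l; first by rewrite addr_ge0 // ltW.
    apply: lerD; last by rewrite ler_wpM2l // ltW.
    by rewrite -real_normK ?num_real // lerXn2r ?nnegrE ?addr_ge0 ?sqr_ge0.
  apply: (le_trans (ler_norm _)); rewrite normrN.
  have -> : 2 * x * B * x * (x ^+ 2 - b.+1%:R) =
      2 * B * (x ^+ 2 * (x ^+ 2 - b.+1%:R)) by ring.
  have -> : 2 * lambda ^+ 2 * B * (lambda ^+ 2 + b.+1%:R) =
      2 * B * (lambda ^+ 2 * (lambda ^+ 2 + b.+1%:R)) by ring.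
  have B20 : 0 <= 2 * B by rewrite mulr_ge0 // ltW.
  rewrite normrM (ger0_norm B20) (ler_wpM2l B20) //.
  by rewrite normrM ler_pM // ger0_norm ?sqr_ge0.
move=> H; apply: (@le_trans _ _ (beta ^+ (2 * k) * E0)); last first.
  by rewrite mulrC ler_wpM2r // exprn_ge0 // ltW.
apply: le_trans H.
have xyz : 2 * x * B * z * y <= lambda * beta * (y ^+ 2 + B * z ^+ 2).
  have -> : 2 * x * B * z * y = (x * beta) * (2 * (beta * z) * y) by rewrite /B; ring.
  apply: (le_trans (ler_norm _)).
  rewrite normrM ler_pM //.
    by rewrite normrM (gtr0_norm beta0) ler_wpM2r // ltW.
  have := sqr_ge0 (beta * z - y); have := sqr_ge0 (beta * z + y).
  by rewrite ler_norml /B; nra.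
apply: (@le_trans _ _ ((B + b%:R - lambda * beta) * (y ^+ 2 + B * z ^+ 2))).
  rewrite /g mulrC -mulrA ler_wpM2l ?subr_ge0 ?(ltW lb) //.
  by rewrite lerDr sqr_ge0.
by rewrite mulrBl lerB.
Qed.

(** At beta = b the last two inequalities are strict, as b < b ^ 2 and
    lambda < b + 1, so they persist for beta slightly below b. *)
Lemma nbpoly_rate (R : realFieldType) b (lambda : R) :
  (1 < b)%N -> 0 <= lambda -> lambda < b.+1%:R ->
  exists beta : R, [/\ 1 < beta, beta < b%:R, b%:R <= beta ^+ 2 &
    lambda * beta < beta ^+ 2 + b%:R].
Proof.
move=> b1 l0; rewrite -addn1 natrD => lb.
have b2 : 2 <= b%:R :> R by rewrite (ler_nat _ 2).
(* Replacing b by b - t lowers beta ^ 2 + b - lambda beta by at most 2 b t from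
   b (b + 1 - lambda), and beta ^ 2 - b by at most 2 b t from b (b - 1). *)
pose t : R := Num.min ((b%:R + 1 - lambda) / 4) ((b%:R - 1) / 3).
have t0 : 0 < t by rewrite lt_min; apply/andP; split; lra.
have t1 : t <= (b%:R + 1 - lambda) / 4 by rewrite ge_min lexx.
have t2 : t <= (b%:R - 1) / 3 by rewrite ge_min lexx orbT.
by exists (b%:R - t); split; nra.
Qed.

Section Mixing.
Variables (R : realType) (G : sgraph) (b : nat).
Hypotheses (b_gt1 : (1 < b)%N) (regG : regular G b.+1).

Definition hit k (u v y : G) : R := nbexp b k u v (fun s => (last v s == y)%:R).

Lemma hit0 u v y : hit 0 u v y = (v == y)%:R. Proof. by []. Qed.

Lemma hitS k u v y :
  hit k.+1 u v y = b%:R^-1 * \sum_(x | adj v x && (x != u)) hit k v x y.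
Proof. by []. Qed.

Let b0 : b%:R != 0 :> R.
Proof. by rewrite pnatr_eq0 -lt0n ltnW. Qed.

(** The entry (v, y) is the number of non-backtracking walks of length [k.+1]
    from v to y: the factor [b%:R ^+ k] turns probabilities into numbers of
    walks. *)
Definition walkmx k : 'M[R]_#|G| :=
  \matrix_(i, j) (b%:R ^+ k *
    \sum_(x | adj (enum_val i) x) hit k (enum_val i) x (enum_val j)).

(** Among the walks of length [k.+1] from [v], those that start with [u] are the
    continuations of the edge (v, u). *)
Lemma hit_walkmx k u v y : adj u v ->
  b%:R ^+ k.+1 * hit k.+1 u v y =
  walkmx k (enum_rank v) (enum_rank y) - b%:R ^+ k * hit k v u y.
Proof.
move=> uv; rewrite mxE !enum_rankK (bigD1 u) /=; last by rewrite adj_sym.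
by rewrite hitS exprSr -mulrA mulVKf // mulrDr [X in X - _]addrC addrK.
Qed.

Lemma walkmx0 : walkmx 0 = adjmx R G.
Proof.
apply/matrixP => i j; rewrite !mxE mul1r big_mkcond (bigD1 (enum_val j)) //=.
rewrite big1 ?addr0 => [|x /negPf xj]; last by rewrite hit0 xj; case: ifP.
by rewrite hit0 eqxx; case: (adj _ _).
Qed.

Lemma sum_adj i (F : G -> R) :
  \sum_(x | adj (enum_val i) x) F x = \sum_l adjmx R G i l * F (enum_val l).
Proof.
rewrite (reindex _ (onW_bij _ (enum_val_bij G))) /= big_mkcond.
by apply: eq_bigr => l _; rewrite mxE; case: ifP => _; rewrite ?mul1r ?mul0r.
Qed.

Lemma walkmxS k i j : walkmx k.+1 i j =
  (adjmx R G *m walkmx k) i j -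
  b%:R ^+ k * \sum_(x | adj (enum_val i) x) hit k x (enum_val i) (enum_val j).
Proof.
rewrite [LHS]mxE mulr_sumr.
under eq_bigr => x ix do rewrite hit_walkmx // enum_valK.
rewrite sumrB mulr_sumr sum_adj mxE; congr (_ - _).
by apply: eq_bigr => l _; rewrite enum_valK.
Qed.

Lemma walkmx1 : walkmx 1 = adjmx R G *m adjmx R G - b.+1%:R%:M.
Proof.
apply/matrixP => i j; rewrite walkmxS walkmx0 [in RHS]mxE [X in _ = _ + X]mxE mul1r.
congr (_ - _); rewrite mxE.
under eq_bigr do rewrite hit0.
rewrite (inj_eq enum_val_inj) sumr_const -(regG (enum_val i)) cardsE.
by case: eqP => _ //; rewrite mul0rn.
Qed.

Lemma walkmxSS k : walkmx k.+2 = adjmx R G *m walkmx k.+1 - b%:R *: walkmx k.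
Proof.
apply/matrixP => i j; rewrite walkmxS [in RHS]mxE [X in _ = _ + X]mxE.
congr (_ - _); rewrite mulr_sumr.
under eq_bigr => x ix do rewrite hit_walkmx 1?adj_sym // !enum_valK.
rewrite sumrB sumr_const -mulr_sumr -/(hit _ _ _ _).
rewrite (_ : #|_| = b.+1); last by rewrite -(regG (enum_val i)) cardsE.
by rewrite !mxE mulrS [X in X - _]addrC addrK mulr_natl.
Qed.

Lemma tr_adjmx : (adjmx R G)^T = adjmx R G.
Proof. by apply/matrixP => i j; rewrite !mxE adj_sym. Qed.

Lemma adjmx_row_sum i : \sum_j adjmx R G i j = b.+1%:R.
Proof.
transitivity (\sum_(x | adj (enum_val i) x) (1 : R)).
  by rewrite sum_adj; apply: eq_bigr => j _; rewrite mulr1.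
by rewrite sumr_const -(regG (enum_val i)) cardsE.
Qed.

End Mixing.

Section Spectrum.
Variables (R : realType) (G : sgraph) (n b : nat) (lambda : R).
Hypotheses (b_gt1 : (1 < b)%N) (n_gt1 : (1 < n)%N)
  (ndlG : ndl_graph G n b.+1 lambda).

(** By regularity d is an eigenvalue.  It cannot be the second or a later one,
    as these are at most lambda < d; so it is the first one, and the others lie
    between the last and the second. *)
Lemma ndl_spectrum : exists2 s : seq R,
  char_poly (adjmx R G) = \prod_(x <- b.+1%:R :: s) ('X - x%:P) &
  size s = n.-1 /\ {in s, forall x, `|x| <= lambda}.
Proof.
case: ndlG => cG rG ld [s [s_sorted charA] lE].
have ss : size s = n.
  have := size_char_poly (adjmx R G); rewrite charA size_prod_XsubC cG.
  by case.
have l1 : s`_1 <= lambda by rewrite lE le_max lexx.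
have l2 : `|s`_n.-1| <= lambda by rewrite lE le_max lexx orbT.
have mono i j : (i <= j < n)%N -> s`_j <= s`_i.
  move=> /andP[ij jn].
  have := @sorted_leq_nth _ (>=%R) (fun x y z yx zy => le_trans zy yx) (@lexx _ _) 0 s s_sorted i j.
  by rewrite !inE ss jn (leq_ltn_trans ij jn) => /(_ isT isT ij).
have ds : b.+1%:R \in s.
  have : root (char_poly (adjmx R G)) b.+1%:R.
    rewrite -eigenvalue_root_char; apply/eigenvalueP; exists (const_mx 1).
      apply/rowP => j; rewrite !mxE mulr1 -(adjmx_row_sum R rG j).
      by apply: eq_bigr => l _; rewrite !mxE mul1r adj_sym.
    have i0 : 'I_#|G| by rewrite cG; exact: Ordinal (ltnW n_gt1).
    by apply/eqP => /rowP/(_ i0)/eqP; rewrite !mxE oner_eq0.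
  by rewrite charA root_prod_XsubC.
have s0 : s`_0 = b.+1%:R.
  have := ds; rewrite -index_mem ss => isn; have := nth_index 0 ds.
  case: (posnP (index b.+1%:R s)) => [-> //|i0 sE].
  have := mono 1%N (index b.+1%:R s); rewrite i0 isn => /(_ isT).
  by rewrite sE => /le_trans/(_ l1); rewrite leNgt ld.
case: s ss s0 mono l1 l2 charA {s_sorted ds lE} => [|x s /= ss /= -> mono l1 l2 charA].
  by move=> /= n0; move: n_gt1; rewrite -n0.
exists s => //; split; first by rewrite -ss.
move=> z /(nthP 0)[i si <-].
have := mono 1%N i.+1; rewrite /= -{1}ss ltnS si => /(_ isT) /= m1.
have := mono i.+1 n.-1; rewrite -[in (_ <= _ < _)%N]ss /= si ltnSn => /(_ isT) /= m2.
rewrite ler_norml (le_trans m1 l1) andbT (le_trans _ m2) //.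
by rewrite lerNl (le_trans _ l2) // -normrN ler_norm.
Qed.

(** An entry is at most the Frobenius norm.  The squared Frobenius norm of the
    symmetric matrix [walkmx k] is the trace of its square, that is the sum of
    the squares of its eigenvalues; subtracting the mean from the entries removes
    exactly the contribution of the eigenvalue d, because all row sums equal
    its eigenvalue. *)
Lemma walkmx_dev k i j :
  exists2 s : seq R, size s = n.-1 /\ {in s, forall x, `|x| <= lambda} &
  (walkmx R G b k i j - b.+1%:R * b%:R ^+ k / n%:R) ^+ 2 <=
  \sum_(x <- s) nbpoly b k x ^+ 2.
Proof.
have [s charA sP] := ndl_spectrum; exists s => //.
case: ndlG => cG rG _ _.
set W := walkmx R G b k; set c := b.+1%:R * b%:R ^+ k.
have n0 : n%:R != 0 :> R by rewrite pnatr_eq0 -lt0n ltnW.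
have M0 := @walkmx0 R G b; have M1 := @walkmx1 R G b b_gt1 rG.
have MS := @walkmxSS R G b b_gt1 rG.
have Wt : W^T = W := trmx_nbmx M0 M1 MS k (@tr_adjmx R G).
have cGR : #|G|%:R = n%:R :> R by rewrite cG.
have Wtm l m : W l m = W m l by rewrite -[in LHS]Wt [LHS]mxE.
have WW : \sum_i \sum_j W i j ^+ 2 = c ^+ 2 + \sum_(x <- s) nbpoly b k x ^+ 2.
  (* The eigenvalue d accounts for the term c ^+ 2. *)
  transitivity (\sum_(x <- b.+1%:R :: s) nbpoly b k x ^+ 2); last first.
    by rewrite big_cons nbpoly_degree.
  rewrite -(mxtrace_nbmx_sqr k M0 M1 MS (@tr_adjmx R G) charA).
  apply: eq_bigr => l _; rewrite -/W mxE; apply: eq_bigr => m _.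
  by rewrite [W m l]Wtm expr2.
have W1 l : \sum_m W l m = c := nbmx_row_sum M0 M1 MS k l (adjmx_row_sum R rG).
have <- : \sum_i \sum_j (W i j - c / n%:R) ^+ 2 = \sum_(x <- s) nbpoly b k x ^+ 2.
  apply/(addrI (c ^+ 2)); rewrite -WW.
  have rowE l : \sum_m (W l m - c / n%:R) ^+ 2 = \sum_m W l m ^+ 2 - c ^+ 2 / n%:R.
    transitivity (\sum_m (W l m ^+ 2 - 2 * (c / n%:R) * W l m + (c / n%:R) ^+ 2)).
      by apply: eq_bigr => m _; rewrite sqrrB; ring.
    rewrite big_split /= sumrB -mulr_sumr W1 sumr_const card_ord -[_ *+ #|_|]mulr_natl cGR.
    by field.
  rewrite (eq_bigr _ (fun l _ => rowE l)) sumrB sumr_const card_ord -[_ *+ #|_|]mulr_natl cGR.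
  by rewrite mulrCA mulfV // mulr1 addrCA subrr addr0.
rewrite (bigD1 i) //= (bigD1 j) //= -addrA lerDl addr_ge0 // sumr_ge0 // => l _.
  exact: sqr_ge0.
by apply: sumr_ge0 => m _; exact: sqr_ge0.
Qed.

End Spectrum.

(** The relation [hit_walkmx] expresses the deviation of [hit k.+1 u v] from its
    mean by an entry of [walkmx k] and the deviation of [hit k v u]; summing the
    geometric bounds on the entries costs a factor 1 / (beta - 1). *)
Lemma hit_mixing (R : realType) b (lambda : R) :
  (1 < b)%N -> lambda < b.+1%:R ->
  exists K rho : R, [/\ 0 < K, 0 < rho, rho < 1 &
    forall (G : sgraph) n, (1 < n)%N -> ndl_graph G n b.+1 lambda ->
    forall k (u v y : G), adj u v ->
    `|hit R b k u v y - n%:R^-1| <= K * n%:R * rho ^+ k].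
Proof.
move=> b1 lb; have [l0|l0] := ltP lambda 0.
  exists 1, 2^-1; split=> //; try lra.
  move=> G n n1 [_ _ _ [s _ lE]]; exfalso; move: l0; apply/negP; rewrite -leNgt lE.
  by rewrite le_max normr_ge0 orbT.
have [beta [be1 beb bb lbe]] := nbpoly_rate b1 l0 lb.
have be0 : 0 < beta := lt_trans ltr01 be1.
have [C C0 CP] := nbpoly_bound be0 bb lbe l0.
have b0 : 0 < b%:R :> R := lt_trans be0 beb.
pose C1 := C + 1; have C10 : 0 < C1 by rewrite /C1; lra.
have CC1 : C <= C1 ^+ 2 by rewrite /C1; nra.
(* The least constant that is stable under one step of the alternating sum,
   plus 1 for the walk of length 0. *)
pose K := 1 + C1 / (beta - 1).
have KC : C1 + K <= K * beta.
  rewrite -subr_ge0 /K (_ : _ - _ = beta - 1); first lra.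
  by field; rewrite gt_eqF // subr_gt0.
have K1 : 1 <= K by rewrite lerDl divr_ge0 ?ltW // subr_gt0.
exists K, (beta / b%:R); split.
- exact: lt_le_trans K1.
- exact: divr_gt0.
- by rewrite ltr_pdivrMr // mul1r.
move=> G n n1 ndlG k u v y uv.
have [cG rG _ _] := ndlG.
have n0 : 1 <= n%:R :> R by rewrite ler1n ltnW.
have bk m : 0 < b%:R ^+ m :> R by rewrite exprn_gt0.
have bek m : 0 < beta ^+ m by rewrite exprn_gt0.
rewrite expr_div_n mulrA ler_pdivlMr // mulrC -(gtr0_norm (bk k)) -normrM.
rewrite mulrBr; elim: k u v uv => [|k IH] u v uv.
  rewrite !mul1r mulr1 hit0.
  have nn : n%:R^-1 <= 1 :> R by rewrite invf_le1 // (lt_le_trans ltr01).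
  have nn0 : 0 <= n%:R^-1 :> R by rewrite invr_ge0.
  have : 1 <= K * n%:R by rewrite mulr_ege1.
  apply: le_trans; rewrite ler_norml; move: nn nn0; set r := n%:R^-1 => nn nn0.
  by case: eqP => _; rewrite ?mulr1n ?mulr0n; apply/andP; split; lra.
have vu : adj v u by rewrite adj_sym.
have := IH _ _ vu; rewrite hit_walkmx //.
set W := walkmx _ _ _ _ _ _.
set e := _ - _; move=> eb.
have -> : W - b%:R ^+ k * hit R b k v u y - b%:R ^+ k.+1 / n%:R =
   (W - b.+1%:R * b%:R ^+ k / n%:R) - e.
  by rewrite /e exprS -[b.+1]addn1 natrD; ring.
have WC : `|W - b.+1%:R * b%:R ^+ k / n%:R| <= C1 * n%:R * beta ^+ k.
  have Cn : 0 <= C1 * n%:R * beta ^+ k by rewrite !mulr_ge0 // ltW.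
  rewrite -ler_sqr ?nnegrE // real_normK ?num_real //.
  have [s [ss sl]] := walkmx_dev b1 n1 ndlG k (enum_rank v) (enum_rank y).
  move=> /le_trans; apply; apply: (@le_trans _ _ (\sum_(x <- s) C * beta ^+ (2 * k))).
    by rewrite big_seq [leRHS]big_seq; apply: ler_sum => x xs; apply: CP; exact: sl.
  rewrite big_const_seq count_predT iter_addr_0 ss -[X in X <= _]mulr_natl.
  rewrite !exprMn -exprM [(k * 2)%N]mulnC mulrA ler_wpM2r // ?(ltW (bek _)) //.
  rewrite [leRHS]mulrC ler_pM //.
  apply: (@le_trans _ _ n%:R); first by rewrite ler_nat leq_pred.
  by rewrite expr2 ler_peMl.
apply: (le_trans (ler_normB _ _)); apply: (le_trans (lerD WC eb)).
rewrite exprS [_ * (beta * _)]mulrA -mulrDl ler_wpM2r // ?(ltW (bek _)) //.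
by rewrite -mulrDl mulrAC ler_wpM2r // ltW // (lt_le_trans ltr01).
Qed.

(** * Girth *)

Section Girth.
Variable G : sgraph.
Implicit Types (u v x y z : G) (s t p q : seq G).

Definition nbseq t : bool :=
  if t is u :: v :: s then adj u v && nbpath u v s else true.

(** Two overlapping vertices are enough to glue non-backtracking walks. *)
Lemma nbseq_cat s1 x y s2 :
  nbseq (s1 ++ [:: x, y & s2]) = nbseq (s1 ++ [:: x; y]) && nbpath x y s2.
Proof.
case: s1 => [|u [|v s]] /=; rewrite ?andbT -?andbA //.
rewrite -[x :: y :: s2]/([:: x; y] ++ s2) catA nbpath_cat /penult.
by rewrite belast_cat !last_cat.
Qed.

Lemma nbseq_behead x t : nbseq (x :: t) -> nbseq t.
Proof. by case: t => [|y [|z s]] //= /and4P[_ -> _ ->]. Qed.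

Lemma nbseq_rev t : nbseq (rev t) = nbseq t.
Proof.
elim: t => [//|x [|y [|z s]] IH] //; first by rewrite /= adj_sym.
rewrite rev_cons; move: IH; rewrite !rev_cons -!cats1 -!catA /= => IH.
rewrite (nbseq_cat _ z y [:: x]) IH /= andbT [adj y x]adj_sym [x == z]eq_sym.
by case: (adj x y) (adj y z) (z != x) => [] [] []; rewrite ?andbF ?andbT.
Qed.

Lemma nbseq_rcons t x : nbseq (rcons t x) -> nbseq t.
Proof. by rewrite -nbseq_rev rev_rcons => /nbseq_behead; rewrite nbseq_rev. Qed.

(** Take a shortest closed stretch.  It is a simple cycle: it has more than two
    edges because the graph has no loop and the walk does not turn back. *)
Lemma nbseq_cycle t : nbseq t -> ~~ uniq t ->
  exists2 c : seq G, graph_cycle c & (size c < size t)%N.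
Proof.
elim: t => [//|x t IH] xt; have [t_uniq|] := boolP (uniq t); last first.
  move=> /(IH (nbseq_behead xt))[c cc ct] _; exists c => //.
  exact: ltnW.
rewrite /= t_uniq andbT negbK => /splitPr tE; case: tE xt t_uniq => p q xt.
rewrite cat_uniq /= negb_or => /and3P[up /andP[xp _] _].
exists (x :: p); last by rewrite /= size_cat /= addnS ltnS leq_addr.
have nbp u v s : nbpath u v s -> path (@adj G) v s.
  by elim: s u v => //= w s IHs u v /and3P[-> _ /IHs].
case: p xt xp up => [|a [|b p]] /= xt xp up; first by rewrite adj_irrefl in xt.
  by move: xt => /and4P[_ _]; rewrite eqxx.
rewrite /graph_cycle /ucycleb /= xp up andbT.
move: xt => /and4P[-> -> _ /nbp]; rewrite /= cat_path rcons_path /=.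
by move=> /and3P[-> ->].
Qed.

(** Strip the common end of the two walks.  If they then arrive through
    different edges, the first walk followed by the reverse of the second one is
    a closed non-backtracking walk, and it contains a cycle that is too short. *)
Lemma nbseq_uniq_path x p q : nbseq (x :: p) -> nbseq (x :: q) ->
  last x p = last x q ->
  (forall c : seq G, graph_cycle c -> (size p + size q < size c)%N) -> p = q.
Proof.
have nil q' : nbseq (x :: q') -> last x q' = x ->
    (forall c : seq G, graph_cycle c -> (size q' < size c)%N) -> q' = [::].
  case/lastP: q' => [//|q' z] xq; rewrite last_rcons => zx gG; exfalso.
  have [|c /gG cq] := nbseq_cycle xq.
    by rewrite zx /= mem_rcons inE eqxx.
  by rewrite /= ltnS leqNgt cq.
elim/last_ind: p q => [|p y IH] q xp xq pq gG.
  by rewrite (nil q).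
case/lastP: q xq pq gG => [|q z] xq.
  by rewrite last_rcons /= => yx gG; rewrite (nil (rcons p y)) ?last_rcons //;
    move=> c /gG; rewrite addn0.
rewrite !last_rcons => yz; rewrite -{z}yz in xq * => gG.
suff pqE : last x p = last x q.
  congr rcons; apply: IH => //.
  - exact: (@nbseq_rcons (x :: p) y).
  - exact: (@nbseq_rcons (x :: q) y).
  - by move=> c /gG; rewrite !size_rcons; lia.
apply/eqP/negPn/negP => ne.
have : nbseq ((x :: rcons p y) ++ rev (x :: q)).
  move: xp xq; rewrite -!rcons_cons lastI [x :: q]lastI.
  move: (belast x p) (last x p) (belast x q) (last x q) ne => p' a q' c ac.
  rewrite -(nbseq_rev (rcons (rcons q' c) y)) !rev_rcons -!cats1 -!catA /= => pay /andP[yc ycq].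
  by rewrite nbseq_cat pay /= yc ycq eq_sym ac.
move=> /nbseq_cycle[|c /gG].
  by rewrite rev_cons -rcons_cat cat_cons /= mem_rcons inE eqxx.
by rewrite size_cat size_rev /= !size_rcons; lia.
Qed.

End Girth.

Section HitBounds.
Variables (R : realType) (G : sgraph) (b h : nat).
Hypotheses (b_gt1 : (1 < b)%N) (regG : regular G b.+1)
  (girthG : forall c : seq G, graph_cycle c -> (2 * h < size c)%N).

Let b_gt0 : (0 < b)%N := ltnW b_gt1.

Lemma sum_nbpath_hit k (u v y : G) :
  b%:R ^+ k * hit R b k u v y =
  #|[set t : k.-tuple G | nbpath u v t && (last v t == y)]%SET|%:R.
Proof.
rewrite -sum_nbpath // -sum1_card natr_sum [RHS]big_mkcond /=.
by apply: eq_bigr => t _; rewrite inE -natrM mulnb; case: (_ && _).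
Qed.

(** At most one of the [b ^ k] equally likely continuations ends at [y]. *)
Lemma hit_short_le k (u v y : G) :
  adj u v -> (k <= h)%N -> hit R b k u v y <= b%:R ^- k.
Proof.
move=> uv kh; rewrite -[leRHS]mul1r ler_pdivlMr ?exprn_gt0 ?ltr0n //.
rewrite mulrC sum_nbpath_hit (ler_nat _ _ 1); apply/card_le1_eqP => t s.
rewrite !inE => /andP[ut /eqP ty] /andP[us /eqP sy]; apply: val_inj => /=.
have nb (r : seq G) : nbpath u v r -> nbseq (v :: r).
  by case: r => //= z r /and3P[-> _ ->].
apply: (nbseq_uniq_path (nb _ us) (nb _ ut)); first by rewrite sy.
by move=> c /girthG; rewrite !size_tuple; lia.
Qed.

(** Condition on all but the last [h] steps. *)
Lemma hit_long_le k (u v y : G) :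
  adj u v -> (h <= k)%N -> hit R b k u v y <= b%:R ^- h.
Proof.
move=> uv hk; rewrite /hit -(subnK hk) nbexp_tower.
apply: (nbexp_le b_gt0 regG uv) => s _ us.
under eq_nbexp do rewrite last_cat.
by apply: hit_short_le => //; apply: nbpath_adj us.
Qed.

(** A return would close a cycle of length at most [2 * h]. *)
Lemma hit_return0 k (u y : G) : (0 < k <= 2 * h)%N -> hit R b k u y y = 0.
Proof.
move=> /andP[k0 kh]; apply/eqP.
have b0 : b%:R ^+ k != 0 :> R by rewrite expf_neq0 // pnatr_eq0 -lt0n.
rewrite -(mulrI_eq0 _ (mulfI b0)) sum_nbpath_hit pnatr_eq0 cards_eq0.
apply/eqP/setP => t; rewrite !inE; apply/negbTE/negP => /andP[ut /eqP ty].
have [||c cc] := @nbseq_cycle _ (y :: t).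
- by case: (val t) ut => //= z r /and3P[-> _ ->].
- case/lastP: (val t) (size_tuple t) ty => /= [tk|r z _].
    by move: k0; rewrite -tk.
  by rewrite last_rcons => ->; rewrite mem_rcons inE eqxx.
by have := girthG cc; rewrite /= size_tuple; lia.
Qed.

End HitBounds.

(** * Many visits to one vertex are unlikely *)

Lemma visitsE (G : sgraph) k (w : k.+1.-tuple G) v : visits w v = count_mem v w.
Proof.
rewrite /visits -[in RHS](map_tnth_enum w) count_map -sum1_card -sum1_count.
by rewrite big_enum_cond; apply: eq_bigl => i; rewrite inE.
Qed.

Lemma max_visitsE (G : sgraph) k (w : k.+1.-tuple G) :
  max_visits w = \max_v count_mem v w.
Proof. by apply: eq_bigr => v _; rewrite visitsE. Qed.

Section Split.
Variables (R : realType) (G : sgraph) (b : nat).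

Lemma nbexp_split a k (u v : G) (f g : seq G -> R) : (a <= k)%N ->
  nbexp b k u v (fun s => f (take a s) * g (drop a s)) =
  nbexp b a u v (fun s => f s * nbexp b (k - a) (penult u v s) (last v s) g).
Proof.
move=> ak; rewrite -{1}(subnKC ak) nbexp_tower; apply: eq_nbexp => s sa _.
rewrite -nbexpZ; apply: eq_nbexp => t _ _.
by rewrite take_size_cat // drop_size_cat.
Qed.

Lemma count_split (v y : G) m s : (m < count_mem y s)%N ->
  exists2 k : 'I_(size s), last v (take k.+1 s) = y
                         & (m <= count_mem y (drop k.+1 s))%N.
Proof.
elim: s v => [//|x s IH] v /=; have [-> |xy] := eqVneq x y.
  by rewrite add1n ltnS => ms; exists ord0; rewrite //= ?take0 ?drop0.
rewrite add0n => /(IH x)[k lk dk].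
by exists (lift ord0 k).
Qed.

End Split.

(** A discrete form of the integral of x ^ m, used to sum the powers in
    [visit_tail_sum]. *)
Lemma exprD_increment_ge (R : realFieldType) (x e : R) m :
  0 <= x -> 0 <= e -> m.+1%:R * x ^+ m * e <= (x + e) ^+ m.+1 - x ^+ m.+1.
Proof.
move=> x0 e0; elim: m => [|m IH]; first by rewrite !expr1 mulr1 mul1r; lra.
have X := exprn_ge0 m x0.
rewrite lerBrDl in IH; rewrite lerBrDl [leRHS]exprS.
apply: le_trans _ (ler_wpM2l (addr_ge0 x0 e0) IH).
rewrite -[m.+2%:R]natr1 !exprS -subr_ge0.
rewrite [leRHS](_ : _ = m.+1%:R * x ^+ m * e * e); last by ring.
by rewrite !mulr_ge0.
Qed.

(** The hypotheses on [a] keep the returns within [tau] steps below the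
    contribution of the later ones for up to [M] visits. *)
Section Upper.
Variables (R : realType) (G : sgraph) (b n tau M : nat) (a : R).
Hypotheses (b_gt0 : (0 < b)%N) (n_gt0 : (0 < n)%N) (regG : regular G b.+1)
  (a_ge0 : 0 <= a) (aM : tau%:R * a * M%:R <= 2)
  (hit_near : forall k (u y : G), adj u y -> (0 < k <= tau)%N ->
     hit R b k u y y <= a)
  (hit_far : forall k (u y : G), adj u y -> (tau < k)%N ->
     hit R b k u y y <= 2 / n%:R).

(** A supersolution of the renewal inequality between m + 1 and m returns.  With
    independent steps of probability 2 / n the bound would be
    (2 T / n) ^ m / m!; the shift by 1 absorbs the returns within [tau] steps and
    the doubling leaves half of the bound to each kind of return. *)
Definition visit_tail m T : R := (4 * (T%:R / n%:R + 1)) ^+ m / m`!%:R.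

Let n0 : 0 < n%:R :> R. Proof. by rewrite ltr0n. Qed.

Let base_ge0 T : 0 <= 4 * (T%:R / n%:R + 1) :> R.
Proof. by rewrite mulr_ge0 // addr_ge0 // divr_ge0. Qed.

Lemma visit_tail_ge0 m T : 0 <= visit_tail m T.
Proof. by rewrite divr_ge0 // exprn_ge0. Qed.

Lemma visit_tail_mono m S T : (S <= T)%N -> visit_tail m S <= visit_tail m T.
Proof.
move=> ST; rewrite /visit_tail ler_wpM2r ?invr_ge0 //.
rewrite lerXn2r ?nnegrE ?base_ge0 // ler_pM2l // lerD2r ler_pM2r ?invr_gt0 //.
by rewrite ler_nat.
Qed.

Lemma visit_tail_sum m T :
  2 / n%:R * \sum_(j < T) visit_tail m j <= visit_tail m.+1 T / 2.
Proof.
elim: T => [|T IH].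
  by rewrite big_ord0 mulr0 divr_ge0 ?visit_tail_ge0.
rewrite big_ord_recr mulrDr /=; apply: le_trans (lerD IH (lexx _)) _.
rewrite -lerBrDl -mulrBl /visit_tail.
set x := 4 * (T%:R / n%:R + 1).
have -> : 4 * (T.+1%:R / n%:R + 1) = x + 4 / n%:R.
  by rewrite /x -addn1 natrD; field; rewrite gt_eqF.
rewrite -mulrBl.
have := exprD_increment_ge m (base_ge0 T : 0 <= x) (divr_ge0 (ler0n _ 4) (ltW n0)).
set D := _ ^+ _ - _ => /= HD.
have m0 : 0 < m.+1`!%:R :> R by rewrite ltr0n fact_gt0.
have m1 : m`!%:R != 0 :> R by rewrite pnatr_eq0 -lt0n fact_gt0.
rewrite ler_pdivlMr // ler_pdivlMr //; apply: le_trans HD.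
rewrite factS natrM le_eqVlt; apply/orP; left; apply/eqP.
by field; rewrite m1 gt_eqF.
Qed.

(** Induction on [m]: sum over the time of some return after which [m] others
    occur.  The walk has then just crossed an edge into [y], so the
    induction hypothesis applies. *)
Lemma return_tail m T (u y : G) : (m <= M)%N -> adj u y ->
  nbexp b T u y (fun s => (m <= count_mem y s)%:R) <= visit_tail m T.
Proof.
elim: m T u => [|m IH] T u mM uy.
  by rewrite (nbexp_cst _ _ _ _ uy) // /visit_tail expr0 mul1r invr1.
have step : nbexp b T u y (fun s => (m < count_mem y s)%:R) <=
    \sum_(k < T) hit R b k.+1 u y y * visit_tail m (T - k.+1).
  apply: (@le_trans _ _ (nbexp b T u y (fun s => \sum_(k < T)
      (last y (take k.+1 s) == y)%:R * (m <= count_mem y (drop k.+1 s))%:R))).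
    apply: le_nbexp => s sT _.
    case: ltnP => ms; last by rewrite sumr_ge0 // => k _; rewrite mulr_ge0.
    have [k lk dk] := count_split y ms; rewrite sT in k lk dk *.
    by rewrite (bigD1 k) //= lk eqxx dk mulr1 lerDl sumr_ge0 // => i _; rewrite mulr_ge0.
  rewrite nbexp_sum; apply: ler_sum => k _.
  rewrite (nbexp_split _ _ _ (fun s => (last y s == y)%:R) (fun s => (m <= count_mem y s)%:R)) //.
  rewrite /hit -nbexpZr; apply: le_nbexp => s _ us.
  case: eqP => [E|_]; last by rewrite !mul0r.
  rewrite !mul1r E; apply: IH; first exact: ltnW.
  by have := nbpath_adj uy us; rewrite E.
apply: (le_trans step).
apply: (@le_trans _ _ (\sum_(k < T) ((k < tau)%:R * a * visit_tail m T
     + 2 / n%:R * visit_tail m (T - k.+1)))).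
  apply: ler_sum => k _; have V0 := visit_tail_ge0 m (T - k.+1).
  have [kt|kt] := ltnP k tau.
    rewrite mul1r -[leLHS]addr0; apply: lerD; last by rewrite mulr_ge0 // divr_ge0.
    apply: ler_pM => //; last by rewrite visit_tail_mono // leq_subr.
      by apply: nbexp_ge0.
    by apply: hit_near.
  by rewrite !mul0r add0r ler_wpM2r // hit_far.
rewrite big_split /= -mulr_sumr.
have -> : \sum_(k < T) visit_tail m (T - k.+1) = \sum_(k < T) visit_tail m k.
  by rewrite (reindex_inj rev_ord_inj); apply: eq_bigr => k _ /=;
    rewrite subnSK // subKn // ltnW.
rewrite [leRHS]splitr; apply: lerD; last exact: visit_tail_sum.
rewrite -!mulr_suml.
have St : \sum_(k < T) (k < tau)%:R <= tau%:R :> R.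
  rewrite -natr_sum ler_nat -(big_mkord xpredT (fun k => (k < tau) : nat)).
  have [Tt|tT] := leqP T tau.
    apply: (@leq_trans (\sum_(0 <= k < T) 1)); last by rewrite sum_nat_const_nat subn0 muln1.
    by apply: leq_sum => k _; case: (_ < _)%N.
  rewrite (big_cat_nat _ (n := tau)) ?(ltnW tT) //=.
  rewrite [X in (_ + X)%N]big_nat_cond [X in (_ + X)%N]big1 ?addn0; last first.
    by move=> k /andP[/andP[tk _] _]; rewrite ltnNge tk.
  apply: (@leq_trans (\sum_(0 <= k < tau) 1)); last by rewrite sum_nat_const_nat subn0 muln1.
  by apply: leq_sum => k _; case: (_ < _)%N.
apply: (@le_trans _ _ (tau%:R * a * visit_tail m T)).
  by rewrite ler_wpM2r ?visit_tail_ge0 // ler_wpM2r.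
have m0 : 0 < m.+1%:R :> R by rewrite ltr0n.
have -> : visit_tail m.+1 T / 2 =
    visit_tail m T * (2 * (T%:R / n%:R + 1) / m.+1%:R).
  rewrite /visit_tail exprSr factS natrM.
  by field; rewrite nat1r !pnatr_eq0 -!lt0n fact_gt0 n_gt0.
rewrite mulrC ler_wpM2l ?visit_tail_ge0 // ler_pdivlMr //.
apply: (@le_trans _ _ 2); last by rewrite ler_peMr // lerDr divr_ge0.
by apply: le_trans aM; rewrite ler_wpM2l ?mulr_ge0 // ler_nat.
Qed.

(** Wait for the first visit, after which [m] returns remain.  This reduces an
    arbitrary starting edge to one that ends at [y], at no cost. *)
Lemma first_visit_tail m T (u v y : G) : (m <= M)%N -> adj u v ->
  nbexp b T u v (fun s => (m < count_mem y s)%:R) <= visit_tail m T.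
Proof.
move=> mM; elim: T u v => [|T IH] u v uv.
  by rewrite nbexp0 /= visit_tail_ge0.
rewrite -add1n nbexp_tower; apply: (nbexp_le b_gt0 regG uv) => -[|x [|z s]] //= _.
rewrite andbT => /andP[vx _]; rewrite add1n.
apply: le_trans (visit_tail_mono m (leqnSn T)).
have [xy|_] := eqVneq x y; last exact: IH.
by rewrite {}xy in vx *; exact: return_tail.
Qed.

(** Union bound over the vertices.  Three visits more than [m] are required: the
    first two positions of the walk are not seen by [nbexp], and one visit
    starts the count of returns. *)
Lemma max_visits_tail m T (w0 : G) : (m <= M)%N ->
  uniform_pr R (nb_walks w0 T.+1) (fun w => (m.+3 <= max_visits w)%N) <=
  #|G|%:R * visit_tail m T.
Proof.
move=> mM.
have -> : uniform_pr R (nb_walks w0 T.+1) (fun w => (m.+3 <= max_visits w)%N) =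
    uniform_pr R (nb_walks w0 T.+1) (fun w => (m.+3 <= \max_v count_mem v w)%N).
  by congr (_%:R / _); apply: eq_card => w; rewrite !inE max_visitsE.
rewrite (uniform_pr_nbexp R w0 T (fun s => (m.+3 <= \max_v count_mem v s)%N) b_gt0 regG).
rewrite mulrC ler_pdivrMr ?ltr0n //.
apply: (@le_trans _ _ (\sum_(x | adj w0 x) #|G|%:R * visit_tail m T)); last first.
  by rewrite sumr_const -[_ *+ _]mulr_natr -(regG w0) cardsE.
apply: ler_sum => x w0x.
apply: (@le_trans _ _ (nbexp b T w0 x (fun s => \sum_y (m < count_mem y s)%:R))).
  apply: le_nbexp => s _ _; case: leqP => ms; first by apply: sumr_ge0.
  have [|y yE] := @bigop.eq_bigmax G (fun v => count_mem v [:: w0, x & s]).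
    by apply/card_gt0P; exists w0.
  rewrite yE in ms; rewrite (bigD1 y) //= (_ : (m < _)%N) ?lerDl ?sumr_ge0 //.
  by move: ms => /=; case: (w0 == y) (x == y) => [] [] /=; lia.
rewrite nbexp_sum (@le_trans _ _ (\sum_(y : G) visit_tail m T)) //.
  by apply: ler_sum => y _; apply: first_visit_tail.
by rewrite sumr_const mulr_natl.
Qed.

End Upper.

(** * Second moment: some vertex is visited often *)

Section Occupation.
Variables (R : realType) (G : sgraph) (b tau : nat).
Hypotheses (b_gt0 : (0 < b)%N) (regG : regular G b.+1).

(** An upper bound for the mean number of visits to [y] in the [tau] steps that
    follow a visit to [x], valid for all edges into [x] at once: it sums over
    these edges.  This costs a constant factor, and the sum over [y] remains
    explicit. *)
Definition near_visits (x y : G) : R :=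
  \sum_(u | adj u x) \sum_(k < tau) hit R b k.+1 u x y.

Lemma hit_ge0 k (u v y : G) : 0 <= hit R b k u v y.
Proof. exact: nbexp_ge0. Qed.

Lemma near_visits_ge0 x y : 0 <= near_visits x y.
Proof. by rewrite !sumr_ge0 // => u _; rewrite sumr_ge0 // => k _; apply: hit_ge0. Qed.

Lemma sum_hit k (u v : G) : adj u v -> \sum_y hit R b k u v y = 1.
Proof.
move=> uv; rewrite -nbexp_sum -[RHS](nbexp_cst b_gt0 regG k 1 uv).
apply: eq_nbexp => s _ _; rewrite (bigD1 (last v s)) //= eqxx big1 ?addr0 //.
by move=> y /negPf; rewrite eq_sym => ->.
Qed.

Lemma sum_near_visits x : \sum_y near_visits x y = (b.+1 * tau)%:R.
Proof.
rewrite exchange_big /= (eq_bigr (fun=> tau%:R)) => [|u ux].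
  rewrite sumr_const -[_ *+ _]mulr_natl natrM; congr (_%:R * _).
  by rewrite -(regG x) cardsE; apply: eq_card => u; rewrite unfold_in [RHS]unfold_in adj_sym.
rewrite exchange_big /= (eq_bigr (fun=> 1)) => [|k _]; last exact: sum_hit.
by rewrite sumr_const card_ord.
Qed.

Lemma nbexp_count a r (u v y : G) : adj u v ->
  nbexp b (a + r) u v (fun s => (count_mem y (drop a s))%:R) =
  \sum_(k < r) hit R b (a + k).+1 u v y.
Proof.
move=> uv; elim: r => [|r IH].
  rewrite big_ord0 addn0 -[RHS](nbexp_cst b_gt0 regG a 0 uv).
  by apply: eq_nbexp => s sa _; rewrite -sa drop_size.
rewrite big_ord_recr /= -IH addnS -addn1 /hit !(nbexp_tower _ (a + r) 1) -nbexpD.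
apply: eq_nbexp => s sa us.
rewrite -[X in _ = X + _](nbexp_cst b_gt0 regG 1 _ (nbpath_adj uv us)) -nbexpD.
apply: eq_nbexp => -[|z [|? ?]] //= _ _; rewrite last_cat /= -natrD; congr _%:R.
rewrite drop_cat; case: ltnP => [_|sa']; first by rewrite count_cat /= addn0.
by rewrite (drop_oversize sa') (eqP (_ : (a - size s == 0)%N)) ?subn_eq0 ?sa ?leq_addr //= addn0.
Qed.

End Occupation.

(** In this section [tau] steps suffice to bring the position within a relative
    error [dl] of the uniform one, and [r] is the number of counted steps of a
    chunk. *)
Section Lower.
Variables (R : realType) (G : sgraph) (b n tau r : nat) (dl K0 : R).
Hypotheses (b_gt0 : (0 < b)%N) (n_gt0 : (0 < n)%N) (r_gt0 : (0 < r)%N)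
  (regG : regular G b.+1) (cardG : #|G| = n)
  (dl_ge0 : 0 <= dl) (dl_lt1 : dl < 1)
  (hit_far : forall k (u v y : G), adj u v -> (tau < k)%N ->
     (1 - dl) / n%:R <= hit R b k u v y <= (1 + dl) / n%:R)
  (near_le : forall x y : G, near_visits R b tau x y <= K0).

Let q : R := (1 + dl) / n%:R.
Let kap (x y : G) : R :=
  (x == y)%:R + near_visits R b tau x y + near_visits R b tau y x.

Let n0 : 0 < n%:R :> R. Proof. by rewrite ltr0n. Qed.
Let r0 : 0 < r%:R :> R. Proof. by rewrite ltr0n. Qed.
Let q_gt0 : 0 < q. Proof. by rewrite divr_gt0 // ltr_wpDr. Qed.

Let kap_ge0 x y : 0 <= kap x y.
Proof. by rewrite !addr_ge0 ?near_visits_ge0. Qed.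

Lemma nbexp_count_le k (u x y : G) : adj u x ->
  nbexp b k u x (fun s => (count_mem y s)%:R) <= near_visits R b tau x y + k%:R * q.
Proof.
move=> ux.
have -> : nbexp b k u x (fun s => (count_mem y s)%:R) = \sum_(i < k) hit R b i.+1 u x y.
  rewrite -(@nbexp_count R G b b_gt0 regG 0 k u x y ux).
  by apply: eq_nbexp => s _ _; rewrite drop0.
apply: (@le_trans _ _ (\sum_(i < k) ((i < tau)%:R * hit R b i.+1 u x y + q))).
  apply: ler_sum => i _; have [it|ti] := ltnP i tau.
    by rewrite mul1r lerDl ltW.
  by rewrite mul0r add0r; have /andP[] := hit_far y ux (ti : (tau < i.+1)%N).
rewrite big_split /= sumr_const card_ord -[q *+ k]mulr_natl lerD2r.
rewrite /near_visits (bigD1 u) //=; apply: (@le_trans _ _ (\sum_(i < tau) hit R b i.+1 u x y)).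
  rewrite (big_ord_widen_cond (maxn k tau) xpredT
    (fun i => (i < tau)%:R * hit R b i.+1 u x y)) ?leq_maxl //.
  rewrite (big_ord_widen_cond (maxn k tau) xpredT
    (fun i => hit R b i.+1 u x y)) ?leq_maxr //.
  rewrite [leLHS]big_mkcond [leRHS]big_mkcond /=; apply: ler_sum => i _.
  by case: ifP; case: ifP => _ _; rewrite ?mul1r ?mul0r ?hit_ge0.
rewrite lerDl sumr_ge0 // => v _; rewrite sumr_ge0 // => i _; exact: hit_ge0.
Qed.

(** The pairs of visits to [x] and [y] at mixed distance give the square of the
    mean, with constant exactly 1: the error must survive an m-th power.  The
    other pairs are simultaneous or close visits and give the term with [kap].
    Induction on the number of counted steps: the first one adds [q * kap x y] for
    itself and the close visits after it, and 2 k q ^ 2 for the mixed ones. *)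
Lemma nbexp_count2_le a k (u v x y : G) : adj u v -> (tau <= a)%N ->
  nbexp b (a + k) u v
    (fun s => (count_mem x (drop a s))%:R * (count_mem y (drop a s))%:R) <=
  k%:R * q * kap x y + (k%:R * q) ^+ 2.
Proof.
move=> uv; elim: k a => [|k IH] a ta.
  apply: (nbexp_le b_gt0 regG uv) => s; rewrite addn0 => <- _.
  by rewrite drop_size !mul0r add0r expr0n.
have hq z : hit R b a.+1 u v z <= q by have /andP[] := hit_far z uv (ta : (tau < a.+1)%N).
rewrite addnS -addSn nbexp_tower.
set F := (X in nbexp _ _ _ _ X <= _).
pose e z s : R := (last v s == z)%:R.
apply: (@le_trans _ _ (nbexp b a.+1 u v (fun s =>
    e x s * (x == y)%:R + e x s * (near_visits R b tau x y + k%:R * q)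
    + e y s * (near_visits R b tau y x + k%:R * q)
    + nbexp b k (penult u v s) (last v s) (fun t =>
        (count_mem x (drop a.+1 (s ++ t)))%:R * (count_mem y (drop a.+1 (s ++ t)))%:R)))).
  apply: le_nbexp => s sa us; rewrite /F.
  case/lastP: s sa us => [//|s z]; rewrite size_rcons => -[sa] us.
  have dE t : drop a (rcons s z ++ t) = z :: t.
    by rewrite cat_rcons drop_size_cat.
  have dE' t : drop a.+1 (rcons s z ++ t) = t.
    by rewrite drop_size_cat // size_rcons sa.
  have st := nbpath_adj uv us; rewrite last_rcons in st.
  rewrite last_rcons; set p := penult _ _ _ in st *.
  apply: (@le_trans _ _ (nbexp b k p z (fun t =>
    ((z == x)%:R * (z == y)%:R + (z == x)%:R * (count_mem y t)%:R
    + (z == y)%:R * (count_mem x t)%:R)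
    + (count_mem x t)%:R * (count_mem y t)%:R))).
    by apply: le_nbexp => t _ _; rewrite dE /= !natrD le_eqVlt; apply/orP; left; apply/eqP; ring.
  rewrite nbexpD; apply: lerD; last first.
    by apply: le_nbexp => t _ _; rewrite dE'.
  rewrite 2!nbexpD !nbexpZ nbexp_cst // /e last_rcons.
  apply: lerD; first apply: lerD.
  - by case: (eqVneq z x) => [->|_]; rewrite ?mul1r ?mul0r.
  - by case: (eqVneq z x) => [zx|_]; rewrite ?mul0r // !mul1r zx;
      apply: nbexp_count_le; rewrite -zx.
  - by case: (eqVneq z y) => [zx|_]; rewrite ?mul0r // !mul1r zx;
      apply: nbexp_count_le; rewrite -zx.
rewrite 3!nbexpD !nbexpZr -(nbexp_tower b a.+1 k u v (fun s =>
  (count_mem x (drop a.+1 s))%:R * (count_mem y (drop a.+1 s))%:R)).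
apply: le_trans (lerD (lexx _) (IH a.+1 (leqW ta))) _.
have kq0 : 0 <= k%:R * q by rewrite mulr_ge0 // ltW.
apply: (@le_trans _ _ ((q * (x == y)%:R + q * (near_visits R b tau x y + k%:R * q)
   + q * (near_visits R b tau y x + k%:R * q)) + (k%:R * q * kap x y + (k%:R * q) ^+ 2))).
  rewrite lerD2r; apply: lerD; first apply: lerD.
  - by apply: ler_wpM2r => //; exact: hq.
  - by apply: ler_wpM2r; [rewrite addr_ge0 // near_visits_ge0|exact: hq].
  - by apply: ler_wpM2r; [rewrite addr_ge0 // near_visits_ge0|exact: hq].
(* The square of k + 1 exceeds that of k by 2k + 1, and only 2k is needed. *)
rewrite /kap -[k.+1%:R]natr1 -subr_ge0.
by rewrite [leRHS](_ : _ = q ^+ 2) ?sqr_ge0 //; ring.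
Qed.

Let C := (tau + r)%N.

Definition chunk_visits (y : G) (s : seq G) : R := (count_mem y (drop tau s))%:R.

(** Multiplying the visits of successive chunks, rather than counting m-tuples
    of times, lets the moments factorize along the walk. *)
Fixpoint chunk_prod m (y : G) (s : seq G) : R :=
  if m is m'.+1 then chunk_visits y (take C s) * chunk_prod m' y (drop C s) else 1.

Lemma chunk_prod_count m y s : chunk_prod m y s != 0 -> (m <= count_mem y s)%N.
Proof.
elim: m s => [//|m IH] s /=; rewrite mulf_eq0 negb_or => /andP[cs /IH ms].
rewrite -[s in count_mem y s](cat_take_drop C) count_cat -add1n leq_add //.
have : (0 < count_mem y (drop tau (take C s)))%N by rewrite lt0n -(pnatr_eq0 R).
rewrite -[X in _ -> (0 < count_mem y X)%N](cat_take_drop tau) count_cat => /leq_trans; apply.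
exact: leq_addl.
Qed.

Lemma chunk_prod_expect m k (u v y : G) : adj u v -> (m * C <= k)%N ->
  (r%:R * ((1 - dl) / n%:R)) ^+ m <= nbexp b k u v (chunk_prod m y).
Proof.
elim: m k u v => [|m IH] k u v uv mk; first by rewrite nbexp_cst.
have Ck : (C <= k)%N by rewrite (leq_trans _ mk) // mulSn leq_addr.
rewrite /= nbexp_split // exprS.
have p0 : 0 <= (1 - dl) / n%:R by rewrite divr_ge0 ?subr_ge0 // ltW.
have lo : r%:R * ((1 - dl) / n%:R) <= nbexp b C u v (chunk_visits y).
  rewrite nbexp_count // -[r in leLHS]card_ord mulr_natl -sumr_const.
  apply: ler_sum => i _.
  by have /andP[] := hit_far y uv (leq_addr i tau : (tau < (tau + i).+1)%N).
apply: (@le_trans _ _ (nbexp b C u v (fun s =>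
    chunk_visits y s * (r%:R * ((1 - dl) / n%:R)) ^+ m))).
  by rewrite nbexpZr ler_wpM2r // exprn_ge0 // mulr_ge0.
apply: le_nbexp => s _ us; rewrite ler_wpM2l //.
by apply: IH; [exact: nbpath_adj us|rewrite leq_subRL // -mulSn].
Qed.

Lemma chunk_prod2_expect m k (u v x y : G) : adj u v -> (m * C <= k)%N ->
  nbexp b k u v (fun s => chunk_prod m x s * chunk_prod m y s) <=
  (r%:R * q * kap x y + (r%:R * q) ^+ 2) ^+ m.
Proof.
elim: m k u v => [|m IH] k u v uv mk; first by rewrite /= nbexp_cst // mulr1.
have Ck : (C <= k)%N by rewrite (leq_trans _ mk) // mulSn leq_addr.
rewrite (@eq_nbexp R G b k u v _ (fun s =>
    (chunk_visits x (take C s) * chunk_visits y (take C s)) *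
    (chunk_prod m x (drop C s) * chunk_prod m y (drop C s)))); last first.
  by move=> s _ _ /=; rewrite mulrACA.
rewrite (nbexp_split _ _ _ (fun t => chunk_visits x t * chunk_visits y t)
  (fun t => chunk_prod m x t * chunk_prod m y t)) // exprS.
set S := _ + _; have S0 : 0 <= S.
  by rewrite addr_ge0 ?sqr_ge0 // mulr_ge0 // mulr_ge0 // ltW.
apply: (@le_trans _ _ (nbexp b C u v (fun s =>
    chunk_visits x s * chunk_visits y s * S ^+ m))).
  apply: le_nbexp => s _ us; rewrite ler_wpM2l ?mulr_ge0 //.
  by apply: IH; [exact: nbpath_adj us|rewrite leq_subRL // -mulSn].
by rewrite nbexpZr ler_wpM2r ?exprn_ge0 // nbexp_count2_le.
Qed.

Let rho : R := r%:R / n%:R.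
Let K1 : R := 2 * K0 + 1.

(** Linear in [x], so that a sum over pairs of vertices is controlled by the sum
    of the [kap x y] and their maximum only. *)
Lemma expr1D_linear_le (F : realFieldType) (x X : F) m :
  0 <= x <= X -> (1 + x) ^+ m <= 1 + m%:R * x * (1 + X) ^+ m.
Proof.
move=> /andP[x0 xX]; elim: m => [|m IH]; first by rewrite !mul0r addr0.
have X0 := le_trans x0 xX.
have P1 : 1 <= (1 + X) ^+ m by rewrite exprn_ege1 // lerDl.
rewrite exprS; apply: le_trans (ler_wpM2l (addr_ge0 ler01 x0) IH) _.
rewrite exprS -[m.+1%:R]natr1.
have m0 : 0 <= m%:R :> F by [].
set P := (1 + X) ^+ m in P1 *; have P0 := le_trans ler01 P1.
rewrite -subr_ge0 [leRHS](_ : _ =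
  m%:R * x * P * (X - x) + x * (P - 1) + x * X * P); last by ring.
by rewrite !addr_ge0 // !mulr_ge0 // subr_ge0.
Qed.

Lemma sum_kap : \sum_x \sum_y kap x y = n%:R * (2 * (b.+1 * tau)%:R + 1).
Proof.
have E (x : G) : \sum_y ((x == y)%:R + near_visits R b tau x y) = 1 + (b.+1 * tau)%:R.
  rewrite big_split /= sum_near_visits //; congr (_ + _).
  rewrite (bigD1 x) //= eqxx big1 ?addr0 //.
  by move=> y /negPf; rewrite eq_sym => ->.
under eq_bigr => x _ do rewrite big_split /= E.
rewrite big_split /= [X in _ + X]exchange_big /=.
under [X in _ + X]eq_bigr => x _ do rewrite sum_near_visits //.
rewrite !sumr_const cardG -mulrnDl -[LHS]mulr_natl; congr (_ * _).
set c := _%:R; ring.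
Qed.

(** The sum of [kap] over all pairs is of order n tau instead of n ^ 2: few
    pairs of vertices are close. *)
Lemma sum_pair_moment m :
  \sum_x \sum_y (r%:R * q * kap x y + (r%:R * q) ^+ 2) ^+ m <=
  (r%:R * q) ^+ (2 * m) * (n%:R ^+ 2 +
    m%:R / rho * (1 + K1 / rho) ^+ m * (n%:R * (2 * (b.+1 * tau)%:R + 1))).
Proof.
have rq0 : 0 < r%:R * q by rewrite mulr_gt0.
have rho0 : 0 < rho by rewrite divr_gt0.
have rq : rho <= r%:R * q.
  by rewrite /rho /q mulrA ler_pM2r ?invr_gt0 // mulrDr mulr1 lerDl mulr_ge0.
set P := (1 + K1 / rho) ^+ m.
have kK x y : kap x y <= K1.
  rewrite /K1 /kap; have := near_le x y; have := near_le y x.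
  by case: eqP => _; rewrite ?mulr1n ?mulr0n; lra.
have P0 : 0 <= P.
  have [w _|e0] := pickP G.
    by rewrite exprn_ge0 // addr_ge0 // divr_ge0 ?(ltW rho0) // (le_trans _ (kK w w)).
  by move: n_gt0; rewrite -cardG eq_card0.
apply: (@le_trans _ _ (\sum_x \sum_y (r%:R * q) ^+ (2 * m) * (1 + m%:R / rho * P * kap x y))).
  apply: ler_sum => x _; apply: ler_sum => y _.
  have -> : r%:R * q * kap x y + (r%:R * q) ^+ 2 = (r%:R * q) ^+ 2 * (1 + kap x y / (r%:R * q)).
    by field; rewrite !gt_eqF.
  rewrite exprMn -exprM ler_wpM2l ?exprn_ge0 ?(ltW rq0) //.
  have kr : kap x y / (r%:R * q) <= kap x y / rho.
    by rewrite ler_wpM2l // lef_pV2.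
  apply: (@le_trans _ _ ((1 + kap x y / rho) ^+ m)).
    by rewrite lerXn2r ?nnegrE ?lerD2l // addr_ge0 // divr_ge0 // ltW.
  apply: le_trans (expr1D_linear_le (X := K1 / rho) m _) _.
    by rewrite divr_ge0 ?(ltW rho0) //= ler_wpM2r ?invr_ge0 ?(ltW rho0).
  by rewrite -/P le_eqVlt; apply/orP; left; apply/eqP; ring.
under eq_bigr do rewrite -mulr_sumr big_split /= -mulr_sumr sumr_const cardG.
rewrite -mulr_sumr big_split /= -mulr_sumr sum_kap sumr_const cardG.
by rewrite -[_ *+ n]mulr_natl expr2.
Qed.

(** Chebyshev's inequality for the sum over [y] of [chunk_prod m y]: if no vertex
    has [m] visits then all these products vanish.  The bound is the ratio of
    the second moment to the square of the mean, minus 1. *)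
Lemma min_visits_tail m T (w0 : G) : (m * C <= T)%N ->
  uniform_pr R (nb_walks w0 T.+1) (fun w => (max_visits w < m)%N) <=
  ((1 + dl) / (1 - dl)) ^+ (2 * m) *
    (1 + m%:R / rho * (1 + K1 / rho) ^+ m * ((2 * (b.+1 * tau)%:R + 1) / n%:R)) - 1.
Proof.
move=> mT; set B := leRHS.
have -> : uniform_pr R (nb_walks w0 T.+1) (fun w => (max_visits w < m)%N) =
    uniform_pr R (nb_walks w0 T.+1) (fun w => (\max_v count_mem v w < m)%N).
  by congr (_%:R / _); apply: eq_card => w; rewrite !inE max_visitsE.
rewrite (uniform_pr_nbexp R w0 T (fun s => (\max_v count_mem v s < m)%N) b_gt0 regG).
rewrite mulrC ler_pdivrMr ?ltr0n //.
apply: (@le_trans _ _ (\sum_(x | adj w0 x) B)); last first.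
  by rewrite sumr_const -[_ *+ _]mulr_natr -(regG w0) cardsE.
apply: ler_sum => x w0x.
pose Y s := \sum_y chunk_prod m y s.
pose mu : R := n%:R * (r%:R * ((1 - dl) / n%:R)) ^+ m.
have d1 : 0 < 1 - dl by rewrite subr_gt0.
have mu0 : 0 < mu by rewrite mulr_gt0 // exprn_gt0 // mulr_gt0 // divr_gt0.
have EY : mu <= nbexp b T w0 x Y.
  rewrite nbexp_sum /mu -cardG mulr_natl -sumr_const cardG.
  by apply: ler_sum => y _; apply: chunk_prod_expect.
have EY2 : nbexp b T w0 x (fun s => Y s ^+ 2) <=
    \sum_x \sum_y (r%:R * q * kap x y + (r%:R * q) ^+ 2) ^+ m.
  rewrite (_ : (fun s => Y s ^+ 2) =
      fun s => \sum_z \sum_y chunk_prod m z s * chunk_prod m y s); last first.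
    by apply/funext => s; rewrite expr2 mulr_suml; apply: eq_bigr => z _; rewrite mulr_sumr.
  rewrite nbexp_sum; apply: ler_sum => z _; rewrite nbexp_sum.
  by apply: ler_sum => y _; apply: chunk_prod2_expect.
(* The square of (Y - mu) / mu, which is 1 where Y vanishes. *)
apply: (@le_trans _ _ (nbexp b T w0 x (fun s =>
    mu ^- 2 * Y s ^+ 2 + (- (2 / mu) * Y s + 1)))).
  apply: le_nbexp => s _ _.
  have -> : mu ^- 2 * Y s ^+ 2 + (- (2 / mu) * Y s + 1) = ((Y s - mu) / mu) ^+ 2.
    by field; rewrite gt_eqF.
  case: ltnP => [ms|_]; last exact: sqr_ge0.
  rewrite /Y big1 => [|y _]; first by rewrite sub0r mulNr mulfV ?gt_eqF // sqrrN expr1n.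
  apply/eqP; apply: contraTT ms => /chunk_prod_count my; rewrite -leqNgt.
  apply: (leq_trans my); apply: leq_trans (bigop.leq_bigmax y).
  by rewrite /= addnA leq_addl.
rewrite !nbexpD !nbexpZ nbexp_cst //.
apply: (@le_trans _ _ (mu ^- 2 * \sum_x \sum_y (r%:R * q * kap x y + (r%:R * q) ^+ 2) ^+ m
   + (- (2 / mu) * mu + 1))).
  apply: lerD; first by rewrite ler_wpM2l // invr_ge0 exprn_ge0 // ltW.
  by rewrite lerD2r !mulNr lerN2 ler_wpM2l // divr_ge0 // ltW.
rewrite mulNr divfK ?gt_eqF // (_ : - 2 + 1 = -1); last by ring.
rewrite /B lerD2r; apply: (@le_trans _ _ (mu ^- 2 *
   ((r%:R * q) ^+ (2 * m) * (n%:R ^+ 2 +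
    m%:R / rho * (1 + K1 / rho) ^+ m * (n%:R * (2 * (b.+1 * tau)%:R + 1)))))).
  by rewrite ler_wpM2l ?sum_pair_moment // invr_ge0 exprn_ge0 // ltW.
rewrite le_eqVlt; apply/orP; left; apply/eqP.
have -> : (1 + dl) / (1 - dl) = (r%:R * q) / (r%:R * ((1 - dl) / n%:R)).
  by rewrite /q; field; rewrite !gt_eqF.
rewrite expr_div_n [(_ * ((1 - dl) / _)) ^+ _]exprM -/rho.
rewrite /mu exprMn -!exprM [(m * 2)%N]mulnC exprM.
set A := (r%:R * _) ^+ 2 ^+ m; set B' := _ ^+ m; set D := _ ^+ (2 * m).
have A0 : A != 0 by rewrite !expf_neq0 // !mulf_neq0 ?invr_eq0 ?gt_eqF.
have rho0 : rho != 0 by rewrite gt_eqF // divr_gt0.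
by field; rewrite A0 rho0 gt_eqF.
Qed.

End Lower.

Section NearVisits.
Variables (R : realType) (G : sgraph) (b h tau : nat).
Hypotheses (b_gt1 : (1 < b)%N) (regG : regular G b.+1)
  (girthG : forall c : seq G, graph_cycle c -> (2 * h < size c)%N)
  (tauh : tau%:R * b%:R ^- h <= 1 :> R).

(** Up to the time [h] the bounds b ^ - k form a convergent geometric series;
    afterwards there are at most [tau] terms b ^ - h. *)
Lemma near_visits_le (x y : G) : near_visits R b tau x y <= b.+1%:R * 2.
Proof.
have b2 : 2 <= b%:R :> R by rewrite ler_nat.
have b0 : 0 < b%:R :> R by rewrite (lt_le_trans _ b2).
apply: (@le_trans _ _ (\sum_(u | adj u x) 2)); last first.
  rewrite sumr_const -[_ *+ _]mulr_natl ler_wpM2r // ler_nat -(regG x) cardsE.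
  by apply: eq_leq; apply: eq_card => u; rewrite unfold_in [RHS]unfold_in adj_sym.
apply: ler_sum => u ux.
apply: (@le_trans _ _ (\sum_(k < tau) (2^-1 ^+ k.+1 + b%:R ^- h))).
  apply: ler_sum => k _; have [kh|hk] := leqP k.+1 h.
    apply: le_trans (hit_short_le R b_gt1 girthG y ux kh) _.
    rewrite -[leLHS]addr0; apply: lerD; last by rewrite invr_ge0 exprn_ge0 // ltW.
    by rewrite -exprVn lerXn2r ?nnegrE ?invr_ge0 ?(ltW b0) // lef_pV2 ?posrE.
  apply: le_trans (hit_long_le R b_gt1 regG girthG y ux (ltnW hk)) _.
  by rewrite lerDr exprn_ge0.
rewrite big_split /= sumr_const card_ord -[_ *+ tau]mulr_natl.
suff : \sum_(k < tau) 2^-1 ^+ k.+1 <= 1 :> R by move: tauh; lra.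
suff -> : \sum_(k < tau) 2^-1 ^+ k.+1 = 1 - 2^-1 ^+ tau :> R.
  by rewrite gerBl exprn_ge0.
elim: (tau) => [|t IH]; first by rewrite big_ord0 subrr.
by rewrite big_ord_recr /= IH exprS; lra.
Qed.

End NearVisits.

(** * Asymptotics *)

Section Numeric.
Variable R : realType.
Implicit Types (l q x e : R).

Lemma expR_sqr_le x : 0 <= x -> x ^+ 2 / 2 <= expR x.
Proof. by move=> x0; have := expR_ge1Dxn 1 x0; rewrite (_ : 2`! = 2)%N //; lra. Qed.

Lemma expR_pow4_le x : 0 <= x -> x ^+ 4 / 24 <= expR x.
Proof.
move=> x0; have := expR_ge1Dxn 3 x0.
by rewrite (_ : 4`! = 24)%N //; lra.
Qed.

(** One term of the exponential series at m. *)
Lemma fact_ge_expR m : m%:R ^+ m / expR m%:R <= m`!%:R :> R.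
Proof.
case: m => [|m]; first by rewrite expr0 expR0 divr1.
rewrite ler_pdivrMr ?expR_gt0 //.
have f0 : 0 < (m.+1)`!%:R :> R by rewrite ltr0n fact_gt0.
have := expR_ge1Dxn m (ler0n R m.+1).
rewrite -(ler_pM2l f0) => /(le_trans _); apply.
by rewrite mulrDr mulr1 mulrCA mulfV ?gt_eqF // mulr1 lerDr ltW.
Qed.

(** With q = ln l the union bound is at most exp l (8 exp 1 / m) ^ m.  For large q
    the base satisfies m / (8 exp 1) >= exp ((1 - e / 8) q), the loss e / 8 in the
    exponent paying for the factors q and 8 exp 1; as
    (1 - e / 8) (1 + e / 2) >= 1 + e / 4, the power exceeds exp ((1 + e / 4) l). *)
Lemma union_bound_small e : 0 < e -> e <= 1 -> exists A : R,
  forall q m, A <= q -> (1 + e) * (expR q / q) - 3 <= m%:R ->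
  expR (expR q) * 8 ^+ m / m`!%:R <= expR (- (e * expR q / 4)).
Proof.
move=> e0 e1; pose c : R := 8 * expR 1.
have c0 : 0 < c by rewrite mulr_gt0 // expR_gt0.
pose th := e / 8; have th0 : 0 < th by rewrite /th; lra.
exists (1 + 6 / e * 2 + 2 * c / th ^+ 2) => q m Aq mq; set l := expR q in mq *.
have B1 : 0 <= 6 / e * 2 by rewrite mulr_ge0 // divr_ge0 // ltW.
have B2 : 0 <= 2 * c / th ^+ 2 by rewrite divr_ge0 ?sqr_ge0 // mulr_ge0 // ltW.
have q0 : 0 < q by lra.
have l0 : 0 < l by rewrite expR_gt0.
have lq : 6 / e <= l / q.
  rewrite ler_pdivlMr //; apply: le_trans (expR_sqr_le (ltW q0)).
  have : 0 <= q * (q - 6 / e * 2) by rewrite mulr_ge0 ?(ltW q0) //; lra.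
  by rewrite expr2; lra.
have m1 : (1 + e / 2) * (l / q) <= m%:R.
  apply: le_trans mq; have : 3 <= e / 2 * (l / q).
    rewrite (_ : 3 = e / 2 * (6 / e)); last by field; rewrite gt_eqF.
    by rewrite ler_wpM2l // divr_ge0 // ltW.
  by lra.
have lq0 : 0 < l / q by rewrite divr_gt0.
have m2 : l / q <= m%:R by apply: le_trans m1; nra.
have m0 : 0 < m%:R :> R by rewrite (lt_le_trans lq0).
have cq : c * q <= expR (th * q).
  have thq : 0 <= th * q by rewrite mulr_ge0 // ltW.
  apply: le_trans (expR_sqr_le thq).
  have cth : 2 * c <= q * th ^+ 2 by rewrite -ler_pdivrMr ?exprn_gt0 //; lra.
  have : 0 <= q * (q * th ^+ 2 - 2 * c) by rewrite mulr_ge0 ?(ltW q0) // subr_ge0.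
  by rewrite [(th * q) ^+ 2]exprMn [q ^+ 2]expr2; move: (th ^+ 2) => t2; nra.
have key : expR ((1 - th) * q) <= m%:R / c.
  rewrite ler_pdivlMr //; apply: le_trans m2; rewrite ler_pdivlMr //.
  have -> : l = expR ((1 - th) * q) * expR (th * q).
    by rewrite -expRD -mulrDl subrK mul1r.
  by rewrite -mulrA ler_pM2l ?expR_gt0.
apply: (@le_trans _ _ (expR l * (m%:R / c) ^- m)).
  rewrite -mulrA ler_pM2l ?expR_gt0 //.
  rewrite ler_pdivrMr ?ltr0n ?fact_gt0 //.
  apply: le_trans (ler_wpM2l _ (fact_ge_expR m)); last first.
    by rewrite invr_ge0 exprn_ge0 // divr_ge0 // ltW.
  rewrite -[X in expR X]mul1r expRM_natr -expr_div_n -exprVn -!exprMn.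
  rewrite le_eqVlt; apply/orP; left; apply/eqP; congr (_ ^+ _).
  by rewrite /c; field; rewrite !gt_eqF ?expR_gt0.
apply: (@le_trans _ _ (expR l * (expR ((1 - th) * q)) ^- m)).
  rewrite ler_pM2l ?expR_gt0 // lef_pV2 ?posrE ?exprn_gt0 ?expR_gt0 ?divr_gt0 //.
  by rewrite lerXn2r ?nnegrE ?expR_ge0 // divr_ge0 // ltW.
rewrite -expRM_natr -expRN -expRD ler_expR.
have : (1 + e / 4) * l <= (1 - th) * q * m%:R; last by lra.
have t1 : 0 <= (1 - th) * q by rewrite mulr_ge0 ?(ltW q0) // /th; lra.
apply: le_trans (ler_wpM2l t1 m1).
rewrite [leRHS](_ : _ = (1 - th) * (1 + e / 2) * l); last by field; rewrite gt_eqF.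
by rewrite ler_pM2r // /th; nra.
Qed.

(** Here y stands for n / r, so that [1 + K1 * y] is at most of order m.  Since
    m <= l / q, a constant multiple of m is below l = exp q for large q, and
    l ^ m <= exp ((1 - e / 2) l): the power gains over n = exp l by more than any
    power of l. *)
Lemma variance_term_small (e K1 D0 eta : R) : 0 < e -> e <= 1 -> 0 <= K1 -> 0 <= D0 -> 0 < eta ->
  exists A : R, forall q m y D, A <= q -> 0 <= y <= 2 * m%:R ->
  0 <= D <= D0 * expR q -> m%:R <= (1 - e / 2) * (expR q / q) ->
  m%:R * y * (1 + K1 * y) ^+ m * (D / expR (expR q)) <= eta.
Proof.
move=> e0 e1 K0 D00 eta0; pose C : R := 768 * D0 / (e ^+ 4 * eta).
have C0 : 0 <= C.
  apply: divr_ge0; apply: mulr_ge0; [exact: ler0n|exact: D00| |exact: ltW].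
  by rewrite exprn_ge0 // ltW.
exists (1 + 2 * K1 + C) => q m y D Aq /andP[y0 ym] /andP[d0 dD] mq.
have q0 : 0 < q by lra.
set l := expR q in dD mq *.
have ql : q <= l by apply: le_trans (expR_ge1Dx q); lra.
have l0 : 0 < l by rewrite expR_gt0.
have lq1 : 1 <= l / q by rewrite ler_pdivlMr // mul1r.
have mlq : m%:R <= l / q by apply: (le_trans mq); nra.
have m0 : 0 <= m%:R :> R by [].
have ml : m%:R <= l.
  by apply: (le_trans mlq); rewrite ler_pdivrMr // ler_peMr ?(ltW l0) //; lra.
have P1 : 1 + K1 * y <= l.
  apply: (@le_trans _ _ ((1 + 2 * K1) * (l / q))); first by nra.
  by rewrite mulrA ler_pdivrMr // mulrC ler_pM2l //; lra.
have P2 : (1 + K1 * y) ^+ m <= expR ((1 - e / 2) * l).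
  apply: (@le_trans _ _ (l ^+ m)).
    by rewrite lerXn2r ?nnegrE ?(ltW l0) // addr_ge0 // mulr_ge0.
  rewrite -expRM_natr ler_expR; apply: le_trans (ler_wpM2l (ltW q0) mq) _.
  by rewrite [leLHS](_ : _ = (1 - e / 2) * l) //; field; rewrite gt_eqF.
have P3 : m%:R * y <= 2 * l ^+ 2.
  by apply: le_trans (ler_wpM2l m0 ym) _; rewrite expr2; nra.
apply: (@le_trans _ _ (2 * l ^+ 2 * expR ((1 - e / 2) * l) * (D0 * l / expR l))).
  apply: ler_pM; rewrite ?divr_ge0 ?expR_ge0 ?mulr_ge0 ?exprn_ge0 //.
    by rewrite addr_ge0 // mulr_ge0.
    by apply: ler_pM; rewrite ?mulr_ge0 ?exprn_ge0 // addr_ge0 // mulr_ge0.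
  by rewrite ler_pM2r // invr_gt0 expR_gt0.
have -> : 2 * l ^+ 2 * expR ((1 - e / 2) * l) * (D0 * l / expR l) =
    2 * D0 * l ^+ 3 / expR (e * l / 2).
  have -> : expR l = expR ((1 - e / 2) * l) * expR (e * l / 2).
    by rewrite -expRD; congr expR; field.
  by field; rewrite !gt_eqF ?expR_gt0.
rewrite ler_pdivrMr ?expR_gt0 //.
have el0 : 0 <= e * l / 2 by rewrite !mulr_ge0 // ltW.
apply: le_trans (ler_wpM2l (ltW eta0) (expR_pow4_le el0)).
have Cl : C <= l by lra.
rewrite /C ler_pdivrMr ?mulr_gt0 ?exprn_gt0 // in Cl.
have -> : eta * ((e * l / 2) ^+ 4 / 24) = l * (e ^+ 4 * eta) * (l ^+ 3 / 384).
  by field.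
have -> : 2 * D0 * l ^+ 3 = 768 * D0 * (l ^+ 3 / 384) by field.
apply: ler_wpM2r; last exact: Cl.
by apply: divr_ge0; rewrite ?ler0n ?exprn_ge0 ?(ltW l0).
Qed.

Lemma bernoulli_le x m : 0 <= x -> x <= 1 -> 1 - m%:R * x <= (1 - x) ^+ m.
Proof.
move=> x0 x1; elim: m => [|m IH]; first by rewrite mul0r subr0.
have x10 : 0 <= 1 - x by lra.
rewrite exprS; apply: le_trans (ler_wpM2l x10 IH).
by rewrite -natr1; have : 0 <= m%:R :> R by []; nra.
Qed.

(** The mixing error [dl] is spoilt by a power of order m, but [m * dl] is still
    small. *)
Lemma power_ratio_le (dl B : R) m : 0 <= dl -> 0 <= B -> m%:R * dl <= 8^-1 -> (0 < m)%N ->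
  ((1 + dl) / (1 - dl)) ^+ (2 * m) * (1 + B) - 1 <= 2 * (B + 4 * (m%:R * dl)).
Proof.
move=> dl0 B0 md m0; have m1 : 1 <= m%:R :> R by rewrite ler1n.
have dl8 : dl <= 8^-1 by nra.
set y := 4 * (m%:R * dl); have y0 : 0 <= y by rewrite /y; nra.
have low : 1 - y <= ((1 - dl) / (1 + dl)) ^+ (2 * m).
  apply: (@le_trans _ _ ((1 - 2 * dl) ^+ (2 * m))).
    have := @bernoulli_le (2 * dl) (2 * m); rewrite natrM.
    by move=> H; apply: le_trans (H _ _); rewrite /y; lra.
  rewrite lerXn2r ?nnegrE ?divr_ge0 //; try lra.
  by rewrite ler_pdivlMr; nra.
have y2 : y <= 2^-1 by rewrite /y; lra.
have up : ((1 + dl) / (1 - dl)) ^+ (2 * m) <= 1 + 2 * y.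
  rewrite -[_ / _]invrK invf_div exprVn.
  apply: (@le_trans _ _ (1 - y)^-1).
    by rewrite lef_pV2 ?posrE //; [apply: lt_le_trans low|]; lra.
  by rewrite -div1r ler_pdivrMr; nra.
apply: (@le_trans _ _ ((1 + 2 * y) * (1 + B) - 1)); last by nra.
by rewrite lerD2r ler_wpM2r // addr_ge0.
Qed.

End Numeric.

(** The two scales of the proof.  With rho the mixing rate, [tau] is about
    4 l / |ln rho|, which brings K n rho ^ tau down to n ^ - 2; and [h] is about
    4 ln l / ln b, so that 2h stays below the girth 10 ln l / ln b while
    b ^ h >= l ^ 4 / b dominates tau l. *)
Lemma mixing_girth_scales (R : realType) b (lambda : R) :
  (1 < b)%N -> lambda < b.+1%:R ->
  exists A c0 : R, 0 < c0 /\ forall (G : sgraph) n,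
    ndl_graph G n b.+1 lambda ->
    ((10 * logb (b.+1%:R - 1) (ln n%:R))%:E <= girth R G)%E ->
    let l : R := ln n%:R in
    A <= ln l -> exists tau h : nat,
    [/\ tau%:R <= c0 * l,
        forall c : seq G, graph_cycle c -> (2 * h < size c)%N,
        tau%:R * b%:R ^- h * l <= 1 &
        forall k (u v y : G), adj u v -> (tau < k)%N ->
         (1 - n%:R^-1) / n%:R <= hit R b k u v y <= (1 + n%:R^-1) / n%:R].
Proof.
move=> b1 lb; have [K [rho [K0 rho0 rho1 mix]]] := hit_mixing b1 lb.
have b2 : 2 <= b%:R :> R by rewrite ler_nat.
have lnr : 0 < - ln rho by rewrite oppr_gt0 ln_lt0 // rho0.
have lnb : 0 < ln b%:R :> R by rewrite ln_gt0 //; lra.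
pose c0 := 4 / - ln rho; have c00 : 0 < c0 by rewrite divr_gt0.
exists (1 + K + c0 * b%:R), c0; split=> // G n ndlG gG l.
set q := ln l => Aq.
have cb0 : 0 <= c0 * b%:R by rewrite mulr_ge0 // ltW.
have q0 : 0 < q by lra.
have l0 : 0 < l.
  by rewrite ltNge; apply/negP => /ln0 E; move: q0; rewrite /q E ltxx.
have lE : expR q = l by rewrite lnK.
have n0 : 0 < n%:R :> R.
  by rewrite ltNge; apply/negP => /ln0 E; move: l0; rewrite /l E ltxx.
have nE : expR l = n%:R by rewrite lnK.
have ql : 1 + q <= l by rewrite -lE expR_ge1Dx.
have nl : 1 + l <= n%:R by rewrite -nE expR_ge1Dx.
have n1 : (1 < n)%N by rewrite -(ltr_nat R); lra.
have cl0 : 0 <= c0 * l by rewrite mulr_ge0 // ltW.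
have qb0 : 0 <= 4 * q / ln b%:R by rewrite divr_ge0 ?mulr_ge0 // ltW.
have [tau /andP[t1 t2]] : exists t : nat, t%:R <= c0 * l < t.+1%:R.
  by exists (Num.truncn (c0 * l)); exact: truncn_itv.
have [h /andP[h1 h2]] : exists h : nat, h%:R <= 4 * q / ln b%:R < h.+1%:R.
  by exists (Num.truncn (4 * q / ln b%:R)); exact: truncn_itv.
exists tau, h; split=> //.
- move=> c cc; rewrite -(ltr_nat R) natrM.
  have : ((10 * logb (b.+1%:R - 1) (ln n%:R))%:E <= ((size c)%:R)%:E :> \bar R)%E.
    by apply: (le_trans gG); apply: ereal_inf_lbound; exists c.
  rewrite lee_fin; apply: lt_le_trans.
  rewrite /logb -/l -/q -[b.+1%:R]natr1 addrK.
  have : 0 < q / ln b%:R by rewrite divr_gt0.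
  move: h1; rewrite -mulrA; lra.
- have bh : l ^+ 4 <= b%:R ^+ h.+1.
    rewrite -lE -expRM_natl -[b%:R]lnK ?posrE ?(lt_le_trans _ b2) // -expRM_natl ler_expR.
    by rewrite -ler_pdivrMr // ltW.
  have bhp : 0 < b%:R ^+ h :> R by rewrite exprn_gt0 // (lt_le_trans _ b2).
  rewrite mulrAC ler_pdivrMr // mul1r.
  rewrite [b%:R ^+ _]exprS in bh.
  have b0 : 0 < b%:R :> R by rewrite (lt_le_trans _ b2).
  rewrite -(ler_pM2l b0); apply: le_trans bh.
  apply: (@le_trans _ _ (b%:R * (c0 * l * l))).
    by rewrite ler_pM2l // ler_pM2r.
  have -> : b%:R * (c0 * l * l) = (c0 * b%:R) * l ^+ 2 by ring.
  have -> : l ^+ 4 = l ^+ 2 * l ^+ 2 by ring.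
  rewrite ler_pM2r ?exprn_gt0 // expr2; apply: (@le_trans _ _ l); first lra.
  by rewrite ler_peMr ?(ltW l0) //; lra.
move=> k u v y uv tk.
have := mix G n n1 ndlG k u v y uv.
have kr : K * n%:R * rho ^+ k <= n%:R^-1 / n%:R.
  have -> : rho ^+ k = expR (k%:R * ln rho) by rewrite expRM_natl lnK.
  have kl : k%:R * ln rho <= - 4 * l.
    have : c0 * l <= k%:R by rewrite (le_trans (ltW t2)) // ler_nat.
    rewrite /c0 mulrAC ler_pdivrMr //; lra.
  have : expR (k%:R * ln rho) <= n%:R ^- 4.
    by rewrite -nE -expRM_natl -expRN ler_expR; lra.
  move=> /(ler_wpM2l (_ : 0 <= K * n%:R)) H; apply: le_trans (H _) _.
    by rewrite mulr_ge0 // ltW.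
  have -> : K * n%:R / n%:R ^+ 4 = K / n%:R * (n%:R^-1 / n%:R).
    by field; rewrite gt_eqF.
  rewrite -[leRHS]mul1r ler_wpM2r ?divr_ge0 ?invr_ge0 //.
  by rewrite ler_pdivrMr // mul1r; lra.
move=> /le_trans /(_ kr); rewrite ler_norml mulrBl mulrDl !mul1r.
by move=> /andP[d1 d2]; apply/andP; split; lra.
Qed.

Lemma lnln_expR (R : realType) (n : nat) (q := ln (ln n%:R) : R) : 0 < q ->
  ln n%:R = expR q /\ n%:R = expR (expR q) :> R.
Proof.
move=> q0; have l0 : 0 < ln n%:R :> R.
  by rewrite ltNge; apply/negP => /ln0 E; move: q0; rewrite /q E ltxx.
have n0 : 0 < n%:R :> R.
  by rewrite ltNge; apply/negP => /ln0 E; move: l0; rewrite E ltxx.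
by rewrite /q !lnK.
Qed.

(** The [tau] discarded steps are of order l, and a chunk has at least about
    n / l steps; so at least half of each chunk is counted. *)
Lemma chunk_length (R : realType) (c0 l : R) (T m tau : nat) :
  0 < c0 -> 48 * (1 + c0) <= l -> T.+1%:R = expR l -> m%:R <= l ->
  tau%:R <= c0 * l -> (0 < m)%N ->
  exists r, [/\ (0 < r)%N, (m * (tau + r) <= T)%N
    & T.+1%:R / (2 * m%:R) <= r%:R :> R].
Proof.
move=> c0_gt0 cl nE ml tl m_gt0.
have m0 : 0 < m%:R :> R by rewrite ltr0n.
have l1 : 1 <= l by lra.
have l0 : 0 < l by lra.
have n0 : 0 < T.+1%:R :> R by rewrite ltr0n.
have Nl : 2 * l * (1 + c0 * l) <= T.+1%:R.
  rewrite nE; apply: le_trans (expR_pow4_le (ltW l0)).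
  have H : 48 * (1 + c0) <= l * l.
    by apply: (le_trans cl); rewrite ler_peMr ?(ltW l0).
  rewrite ler_pdivlMr // (_ : l ^+ 4 = l * l * (l * l)); last by ring.
  apply: le_trans (ler_wpM2l (_ : 0 <= l * l) H); last by rewrite mulr_ge0 // ltW.
  have : 0 <= 48 * l * (l - 1) by rewrite !mulr_ge0 ?(ltW l0) ?ler0n ?subr_ge0.
  by move=> H1; rewrite -subr_ge0 (_ : _ - _ = 48 * l * (l - 1)) //; ring.
have tm : T.+1%:R <= ((T %/ m)%:R + 1) * m%:R :> R.
  by rewrite natr1 -natrM ler_nat ltn_ceil.
have rl : T.+1%:R / (2 * m%:R) + tau%:R <= (T %/ m)%:R :> R.
  have H : T.+1%:R / m%:R <= (T %/ m)%:R + 1 :> R by rewrite ler_pdivrMr.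
  have H2 : 1 + c0 * l <= T.+1%:R / (2 * m%:R).
    rewrite ler_pdivlMr ?mulr_gt0 //; apply: le_trans Nl.
    rewrite mulrC ler_wpM2r ?ler_pM2l //.
    by rewrite addr_ge0 // mulr_ge0 // ltW.
  have E : T.+1%:R / m%:R = 2 * (T.+1%:R / (2 * m%:R)) :> R by field; rewrite gt_eqF.
  by rewrite {}E in H; move: (_ / (2 * m%:R)) H H2 => x; lra.
have Nm0 : 0 < T.+1%:R / (2 * m%:R) :> R by rewrite divr_gt0 // mulr_gt0.
have taut : (tau < T %/ m)%N.
  by rewrite -(ltr_nat R); apply: lt_le_trans rl; rewrite ltrDr.
exists (T %/ m - tau)%N; split.
- by rewrite subn_gt0.
- by rewrite (subnKC (ltnW taut)) mulnC; exact: leq_trunc_div.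
- by rewrite natrB ?(ltnW taut) // lerBrDr.
Qed.

Section Bounds.
Variables (R : realType) (b : nat) (lambda : R).
Hypotheses (b1 : (1 < b)%N) (lb : lambda < b.+1%:R).

Definition max_visits_scale (n : nat) : R := ln n%:R / ln (ln n%:R).

Lemma max_visits_upper (e eta : R) : 0 < e -> e <= 1 -> 0 < eta ->
  exists A : R, forall (G : sgraph) n, ndl_graph G n b.+1 lambda ->
  ((10 * logb (b.+1%:R - 1) (ln n%:R))%:E <= girth R G)%E ->
  A <= ln (ln n%:R) -> forall w0 : G,
  uniform_pr R (nb_walks w0 n)
    (fun w => (1 + e) * max_visits_scale n < (max_visits w)%:R) <= eta.
Proof.
move=> e0 e1 eta0.
have [A1 [c0 [c00 par]]] := mixing_girth_scales b1 lb.
have [A2 fb] := union_bound_small e0 e1.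
exists (`|A1| + `|A2| + 6 + 4 / (e * eta)) => G n ndlG gG Aq w0.
have B0 : 0 <= 4 / (e * eta) by rewrite divr_ge0 // mulr_ge0 // ltW.
have N1 := ler_norm A1; have N2 := ler_norm A2.
have M1 := normr_ge0 A1; have M2 := normr_ge0 A2.
have [|tau [h [tl gh th hf]]] := par G n ndlG gG; first lra.
have q0 : 0 < ln (ln n%:R) :> R by lra.
have [lE nE] := lnln_expR q0.
have [cG rG _ _] := ndlG.
rewrite /max_visits_scale; set q := ln (ln n%:R) in Aq q0 lE nE *.
rewrite {}lE in tl th *; clearbody q.
set l := expR q in nE tl th *.
have l0 : 0 < l by rewrite expR_gt0.
have L3 : 3 <= l / q.
  rewrite ler_pdivlMr //; apply: le_trans (expR_sqr_le (ltW q0)).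
  by rewrite expr2; nra.
have Ll : l / q <= l by rewrite ler_pdivrMr // ler_peMr ?(ltW l0) //; lra.
set x := (1 + e) * (l / q).
have x3 : 3 <= x by rewrite /x; nra.
have x2 : x <= 2 * l by rewrite /x; nra.
have [j /andP[jx xj]] : exists j : nat, j%:R <= x < j.+1%:R.
  by exists (Num.truncn x); apply: truncn_itv; lra.
have j2 : (2 < j.+1)%N by rewrite -(ltr_nat R); apply: le_lt_trans xj; lra.
have b0 := ltnW b1.
case: n => [|T] in ndlG gG nE hf cG *.
  by move: (expR_gt0 l); rewrite -nE ltxx.
have n0 : 0 < T.+1%:R :> R by rewrite ltr0n.
have a0 : 0 <= b%:R ^- h :> R by rewrite invr_ge0 exprn_ge0.
(* Three visits are lost in [max_visits_tail], and j + 1 visits are available. *)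
pose m := (j - 2)%N.
have mj : m%:R = j%:R - 2 :> R by rewrite /m natrB.
have aM : tau%:R * b%:R ^- h * m%:R <= 2 :> R.
  have t0 : 0 <= tau%:R * b%:R ^- h :> R by rewrite mulr_ge0.
  apply: (@le_trans _ _ (tau%:R * b%:R ^- h * (2 * l))); last by lra.
  by apply: ler_wpM2l => //; lra.
have near : forall k (u y : G), adj u y -> (0 < k <= tau)%N ->
    hit R b k u y y <= b%:R ^- h.
  move=> k u y uy /andP[k0 kt]; have [kh|hk] := leqP k (2 * h).
    by rewrite (hit_return0 R b1 gh) ?k0.
  by apply: (hit_long_le R b1 rG gh y uy); rewrite (leq_trans _ (ltnW hk)) // leq_pmull.
have far : forall k (u y : G), adj u y -> (tau < k)%N -> hit R b k u y y <= 2 / T.+1%:R.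
  move=> k u y uy tk; have /andP[_ /le_trans] := hf k u y y uy tk; apply.
  rewrite ler_pM2r ?invr_gt0 //.
  have : T.+1%:R^-1 <= 1 :> R by rewrite invf_le1 // ler1n.
  by move: (_^-1) => z; lra.
have := @max_visits_tail R G b T.+1 tau m (b%:R ^- h) b0 isT rG a0 aM near far m T w0 (leqnn m).
move=> tail; apply: le_trans (le_trans _ tail) _.
  apply: uniform_pr_le => w xw.
  have : (j < max_visits w)%N by rewrite -(ltr_nat R); apply: le_lt_trans xw.
  move: (max_visits w) j2; rewrite /m; clear => M j2 jM.
  by case: j j2 jM => [|[|i]] //; rewrite !subSS subn0.
rewrite cG /visit_tail mulrA.
apply: (@le_trans _ _ (expR l * 8 ^+ m / m`!%:R)).
  rewrite nE ler_wpM2r ?invr_ge0 // ler_pM2l ?expR_gt0 //.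
  have : T%:R / T.+1%:R <= 1 :> R by rewrite ler_pdivrMr // mul1r ler_nat.
  have : 0 <= T%:R / T.+1%:R :> R by rewrite divr_ge0.
  rewrite nE; move: (_ / _) => z z0 z1.
  by rewrite lerXn2r ?nnegrE; lra.
apply: le_trans (fb q m _ _) _; first lra.
  rewrite -/l -/x mj -[j.+1%:R]natr1 in xj *; lra.
rewrite expRN -/l.
have el : eta^-1 <= expR (e * l / 4).
  apply: le_trans (expR_ge1Dx _).
  have lq : 1 + q <= l := expR_ge1Dx q.
  have : 4 / (e * eta) <= l by lra.
  rewrite ler_pdivrMr ?mulr_gt0 // => H.
  rewrite -div1r ler_pdivrMr //; lra.
by rewrite -[leRHS]invrK lef_pV2 ?posrE ?invr_gt0 ?expR_gt0.
Qed.

Lemma max_visits_lower (e eta : R) : 0 < e -> e <= 1 -> 0 < eta ->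
  exists A : R, forall (G : sgraph) n, ndl_graph G n b.+1 lambda ->
  ((10 * logb (b.+1%:R - 1) (ln n%:R))%:E <= girth R G)%E ->
  A <= ln (ln n%:R) -> forall w0 : G,
  uniform_pr R (nb_walks w0 n)
    (fun w => (max_visits w)%:R < (1 - e) * max_visits_scale n) <= eta.
Proof.
move=> e0 e1 eta0.
have [A1 [c0 [c00 par]]] := mixing_girth_scales b1 lb.
pose K0 : R := b.+1%:R * 2; pose K1 := 2 * K0 + 1.
pose D0 : R := 2 * b.+1%:R * c0 + 1.
have K10 : 0 <= K1 by rewrite /K1 /K0 addr_ge0 // !mulr_ge0.
have D00 : 0 <= D0 by rewrite addr_ge0 // !mulr_ge0 // ltW.
have eta4 : 0 < eta / 4 by rewrite divr_gt0.
have [A2 pb] := variance_term_small e0 e1 K10 D00 eta4.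
pose c1 := 48 * (1 + c0).
exists (`|A1| + `|A2| + 16 + 4 / e + 32 / eta + c1) => G n ndlG gG Aq w0.
have c10 : 0 <= c1 by rewrite /c1; lra.
have B0 : 0 <= 4 / e by rewrite divr_ge0 // ltW.
have B1 : 0 <= 32 / eta by rewrite divr_ge0 // ltW.
have N1 := ler_norm A1; have N2 := ler_norm A2.
have M1 := normr_ge0 A1; have M2 := normr_ge0 A2.
have [|tau [h [tl gh th hf]]] := par G n ndlG gG; first lra.
have q0 : 0 < ln (ln n%:R) :> R by lra.
have [lE nE] := lnln_expR q0.
have [cG rG _ _] := ndlG.
rewrite /max_visits_scale; set q := ln (ln n%:R) in Aq q0 lE nE *.
rewrite {}lE in tl th *; clearbody q.
set l := expR q in nE tl th *.
have l0 : 0 < l by rewrite expR_gt0.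
have lq : 1 + q <= l := expR_ge1Dx q.
have Ll : l / q <= l by rewrite ler_pdivrMr // ler_peMr ?(ltW l0) //; lra.
have L2 : 2 / e <= l / q.
  rewrite ler_pdivlMr //; apply: le_trans (expR_sqr_le (ltW q0)).
  have : 0 <= q * (q - 4 / e) by rewrite mulr_ge0 ?(ltW q0) //; lra.
  by rewrite expr2; lra.
have eL : 1 <= e / 2 * (l / q).
  apply: (@le_trans _ _ (e / 2 * (2 / e))); last by rewrite ler_wpM2l // divr_ge0 // ltW.
  by rewrite le_eqVlt; apply/orP; left; apply/eqP; field; rewrite gt_eqF.
have L0 : 0 < l / q by rewrite divr_gt0.
set x := (1 - e) * (l / q).
have x0 : 0 <= x by rewrite mulr_ge0 ?(ltW L0) //; lra.
have [j /andP[jx xj]] : exists j : nat, j%:R <= x < j.+1%:R.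
  by exists (Num.truncn x); apply: truncn_itv.
pose m := j.+1; have m0 : 0 < m%:R :> R by rewrite ltr0n.
have mx : m%:R <= (1 - e / 2) * (l / q).
  by rewrite /m -natr1; move: jx; rewrite /x; lra.
have ml : m%:R <= l by apply: (le_trans mx); nra.
have b0 := ltnW b1.
case: n => [|T] in ndlG gG nE hf cG *.
  by move: (expR_gt0 l); rewrite -nE ltxx.
have n0 : 0 < T.+1%:R :> R by rewrite ltr0n.
set N := T.+1%:R in nE n0 *.
have [|r [r_gt0 mT rN]] := chunk_length c00 _ nE ml tl (ltn0Sn j).
  by rewrite -/c1; lra.
have rR : 0 < r%:R :> R by rewrite ltr0n.
have Nm0 : 0 < N / (2 * m%:R) by rewrite divr_gt0 // mulr_gt0.
have dl0 : 0 <= N^-1 by rewrite invr_ge0 ltW.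
have mN : m%:R * N^-1 <= 2 / l.
  rewrite ler_pdivrMr // mulrAC ler_pdivlMr //.
  rewrite nE; apply: le_trans (ler_wpM2l _ (expR_sqr_le (ltW l0))) => //.
  by rewrite expr2; nra.
have l16 : 2 / l <= 8^-1 by rewrite ler_pdivrMr //; lra.
have leta : 2 / l <= eta / 16.
  have : 32 / eta <= l by lra.
  by rewrite !ler_pdivrMr // mulrAC ler_pdivlMr //; lra.
have dl1 : N^-1 < 1 by rewrite invf_lt1 // nE; have := expR_ge1Dx l; lra.
have near : forall x y : G, near_visits R b tau x y <= K0.
  apply: (near_visits_le (h := h) b1 rG gh).
  have t0 : 0 <= tau%:R * b%:R ^- h :> R by rewrite mulr_ge0 // invr_ge0 exprn_ge0.
  by apply: le_trans th; rewrite ler_peMr //; lra.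
have tail := @min_visits_tail R G b T.+1 tau r N^-1 K0 b0 isT r_gt0 rG cG dl0 dl1 hf near m T w0 mT.
apply: le_trans (le_trans _ tail) _.
  apply: uniform_pr_le => w xw.
  by rewrite -(ltr_nat R); apply: (lt_trans xw xj).
rewrite -/N -/K1; set y := (r%:R / N)^-1.
have y0 : 0 <= y by rewrite invr_ge0 divr_ge0 // ltW.
have ym : y <= 2 * m%:R.
  by rewrite /y invf_div ler_pdivrMr // mulrC -ler_pdivrMr ?mulr_gt0.
set D := 2 * (b.+1 * tau)%:R + 1; have D0' : 0 <= D by rewrite addr_ge0 // mulr_ge0.
have DD : D <= D0 * l.
  rewrite /D /D0 natrM [leRHS]mulrDl mul1r; apply: lerD; last lra.
  by rewrite -!mulrA !ler_wpM2l.
have y0m : 0 <= y <= 2 * m%:R by rewrite y0.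
have dD : 0 <= D <= D0 * l by rewrite D0'.
have Bb := pb q m y D (_ : A2 <= q) y0m dD mx; rewrite -/l -nE in Bb.
apply: le_trans (power_ratio_le dl0 _ _ _) _ => //.
- rewrite !mulr_ge0 // ?exprn_ge0 ?addr_ge0 ?mulr_ge0 //.
- exact: le_trans mN l16.
have {}Bb := Bb _; have : A2 <= q by lra.
move=> /Bb; move: mN leta; clear.
move: (_ * (D / N)) (m%:R / N) (2 / l) => X Z W; lra.
Qed.

End Bounds.

Lemma near_lnln_ge (R : realType) (n : nat -> nat) (A : R) : n @ \oo --> \oo ->
  \forall k \near \oo, A <= ln (ln (n k)%:R).
Proof.
move=> /cvgnyPge /(_ (Num.truncn (expR (expR A))).+1); apply: filterS => k nk.
have /andP[_ tr] := truncn_itv (expR_ge0 (expR A)).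
have nE : expR (expR A) <= (n k)%:R by apply: (le_trans (ltW tr)); rewrite ler_nat.
have l1 : expR A <= ln (n k)%:R.
  by rewrite -[leLHS]expRK ler_ln ?posrE ?expR_gt0 // (lt_le_trans _ nE) ?expR_gt0.
by rewrite -[leLHS]expRK ler_ln ?posrE ?expR_gt0 // (lt_le_trans _ l1) ?expR_gt0.
Qed.

Theorem theorem1p3 (R : realType) (d : nat) (lambda : R)
    (hd : (3 <= d)%N) (hlambda : lambda < d%:R)
    (n : nat -> nat) (G : nat -> sgraph)
    (hG : forall k, ndl_graph (G k) (n k) d lambda)
    (hn : n @ \oo --> \oo)
    (hgirth : forall k,
      ((10 * logb (d%:R - 1) (ln (n k)%:R))%:E <= girth R (G k))%E)
    (w0 : forall k, G k) (eps : R) (heps : 0 < eps) :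
  (fun k : nat =>
     let L : R := ln (n k)%:R / ln (ln (n k)%:R) in
     uniform_pr R (nb_walks (w0 k) (n k))
       (fun w => (1 - eps) * L <= (max_visits w)%:R <= (1 + eps) * L))
    @ \oo --> (1 : R).
Proof.
case: d hd hlambda hG hgirth => [//|b] b1 lb hG hgirth.
(* Decreasing eps shrinks the event, so eps may be taken at most 1. *)
pose e := Num.min eps 1.
have e0 : 0 < e by rewrite lt_min heps ltr01.
have e1 : e <= 1 by rewrite ge_min lexx orbT.
have ee : e <= eps by rewrite ge_min lexx.
apply/cvgrPdist_le => eta eta0.
have eta2 : 0 < eta / 2 by rewrite divr_gt0.
have [A1 up] := max_visits_upper b1 lb e0 e1 eta2.
have [A2 lo] := max_visits_lower b1 lb e0 e1 eta2.
near=> k.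
have q0 : 1 <= ln (ln (n k)%:R) :> R by near: k; exact: near_lnln_ge.
have A1k : A1 <= ln (ln (n k)%:R) by near: k; exact: near_lnln_ge.
have A2k : A2 <= ln (ln (n k)%:R) by near: k; exact: near_lnln_ge.
have {}up := up _ _ (hG k) (hgirth k) A1k (w0 k).
have {}lo := lo _ _ (hG k) (hgirth k) A2k (w0 k).
have q0' := lt_le_trans ltr01 q0.
have [lE nE] := lnln_expR q0'.
have [cG rG _ _] := hG k.
set L : R := ln (n k)%:R / ln (ln (n k)%:R).
have L0 : 0 <= L by rewrite divr_ge0 ?(ltW q0') // lE expR_ge0.
rewrite ger0_norm ?subr_ge0 ?uniform_pr_le1 // lerBlDr.
have tot : uniform_pr R (nb_walks (w0 k) (n k)) predT = 1.
  case: (n k) nE => [|T _]; last by apply: uniform_pr_walks1 rG; apply: (@ltnW 1).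
  by move=> E; have := expR_gt0 (expR (ln (ln 0%:R)) : R); rewrite -E ltxx.
rewrite -[leLHS]tot [eta]splitr -addrA.
apply: le_trans _ (lerD up (lerD lo (lexx _))).
apply: le_trans _ (lerD (lexx _) (uniform_pr_or _ _ _ _)).
apply: le_trans _ (uniform_pr_or _ _ _ _).
apply: uniform_pr_le => w _; rewrite /max_visits_scale -/L.
case: ltP => //= H1; case: ltP => //= H2; apply/andP; split.
  by apply: le_trans H2; rewrite ler_wpM2r // lerD2l lerN2.
by apply: (le_trans H1); rewrite ler_wpM2r // lerD2l.
Unshelve. all: by end_near.
Qed.
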